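(* The Butcher group $G_{\mathrm{TM}}$, with the manifold structure given by the global chart $G_{\mathrm{TM}}\to\mathbb R^{\mathcal T}$, $a\mapsto a-e$, is a real analytic infinite-dimensional Lie group modelled on the Fréchet space $\mathbb{R}^{\mathcal T}$ (with the topology of pointwise convergence).
   Context: Trees: A rooted tree is a non-empty connected finite graph without cycles with a distinguished node (the root); rooted trees are identified if they are isomorphic via a root-preserving graph isomorphism. $\mathcal T$ is the (countable) set of all rooted trees, $\emptyset$ is the empty tree, $\mathcal T_0=\mathcal T\cup\{\emptyset\}$. An ordered subtree of $\tau\in\mathcal T_0$ is a subset $s$ of the vertices of $\tau$ that is connected by edges of $\tau$ and, if non-empty, contains the root of $\tau$; $\mathrm{OST}(\tau)$ is the set of all ordered subtrees. For $s\in\mathrm{OST}(\tau)$, $s_\tau$ is the rooted tree with vertex set $s$ and root and edges induced by $\tau$ ($s_\tau=\emptyset$ if $s=\emptyset$), and $\tau\setminus s$ is the forest (finite collection, with multiplicity, of rooted trees) obtained from $\tau$ by removing $s$ and its adjacent edges. Butcher group: $G_{\mathrm{TM}}=\{a:\mathcal T_0\to\mathbb R\mid a(\emptyset)=1\}$ with multiplication $$(a\cdot b)(\tau)=\sum_{s\in \mathrm{OST}(\tau)} b(s_\tau)\,a(\tau\setminus s),\qquad a(\tau\setminus s)=\prod_{\theta\in\tau\setminus s}a(\theta)$$ (empty product $=1$). The identity is $e$ with $e(\emptyset)=1$ and $e(\tau)=0$ for $\tau\in\mathcal T$. $\mathbb R^{\mathcal T}$ is identified with $\{a\in\mathbb R^{\mathcal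 T_0}\mid a(\emptyset)=0\}$, so $G_{\mathrm{TM}}=e+\mathbb R^{\mathcal T}$ is an affine subspace of $\mathbb R^{\mathcal T_0}$; spaces of tree maps carry the topology of pointwise convergence (product topology), which makes them Fréchet spaces. Calculus (Bastiani / Keller $C^r_c$): A map $f:U\to F$ from an open subset of a locally convex $\mathbb K$-space $E$ ($\mathbb K\in\{\mathbb R,\mathbb C\}$) to a locally convex space $F$ is $C^r_{\mathbb K}$ if all iterated directional derivatives $d^{(k)}f(x,y_1,\dots,y_k)=(D_{y_k}\cdots D_{y_1}f)(x)$, $k\le r$, exist and define continuous maps $U\times E^k\to F$. Holomorphic means $C^\infty_{\mathbb C}$; $f$ (with $E,F$ real) is real analytic if it extends to a holomorphic map into $F_{\mathbb C}$ on an open neighbourhood of $U$ in the complexification $E_{\mathbb C}$. A Lie group is a group with a smooth manifold structure modelled on a locally convex space such that multiplication and inversion are smooth; it is a real analytic Lie group if these operations are real analytic. *)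

(* Defs.v *)
From HB Require Import structures.
From mathcomp Require Import all_boot all_order all_algebra generic_quotient.
From mathcomp Require Import all_classical all_reals all_analysis.
From mathcomp Require Import finmap complex.

Set Implicit Arguments.
Unset Strict Implicit.
Unset Printing Implicit Defensive.

Import Order.TTheory GRing.Theory Num.Theory.

Local Open Scope classical_set_scope.
Local Open Scope ring_scope.

Section PtwsTvs.
Context (K : numFieldType) (X : Type) (F : tvsType K).

HB.instance Definition _ := GRing.Lmodule.copy {ptws X -> F} (X -> F).

Let ptws_cvgP (S : Type) (G : set_system S) (FG : Filter G)
  (g : S -> {ptws X -> F}) (f : {ptws X -> F}) :
  (forall i, g ^~ i @ G --> f i) -> g @ G --> f.
Proof.
move=> H; apply/cvg_sup => i U [V [[W oW <-] Wf] WU].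
apply: filterS WU _ => /=.
by apply: H; apply: open_nbhs_nbhs.
Qed.
Let proj_cts i : continuous (fun f : {ptws X -> F} => f i).
Proof. exact: (@proj_continuous {classic X} (fun=> F) i). Qed.

Let ptws_add_continuous :
  continuous (fun x : {ptws X -> F} * {ptws X -> F} => x.1 + x.2).
Proof.
move=> [f g]; apply: ptws_cvgP => i.
have H := @add_continuous F (f i, g i).
apply: (cvg_comp (fun p : {ptws X -> F} * {ptws X -> F} => (p.1 i, p.2 i))
   _ _ H).
apply: cvg_pair => /=.
  by apply: (cvg_comp fst (fun f : {ptws X -> F} => f i)); [exact: cvg_fst|exact: proj_cts].
by apply: (cvg_comp snd (fun f : {ptws X -> F} => f i)); [exact: cvg_snd|exact: proj_cts].
Qed.

Let ptws_scale_continuous :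
  continuous (fun z : K^o * {ptws X -> F} => z.1 *: z.2).
Proof.
move=> [k g]; apply: ptws_cvgP => i /=.
have H := @scale_continuous K F (k, g i).
apply: (cvg_comp (fun p : K^o * {ptws X -> F} => (p.1, p.2 i)) _ _ H).
apply: (@cvg_pair _ _ _ _ (nbhs (k : K^o)) (nbhs (g i : F))) => /=; first exact: cvg_fst.
by apply: (cvg_comp snd (fun f : {ptws X -> F} => f i)); [exact: cvg_snd|exact: proj_cts].
Qed.

Let ptws_locally_convex : exists2 B : set_system {ptws X -> F},
  (forall b, b \in B -> convex_set b) & basis B.
Proof.
have [B Bconv [Bo Bb]] := @locally_convex K F.
exists [set A | open A /\ convex_set A]; first by move=> b /set_mem [].
split; first by move=> b [].
move=> f U [P [[Q QfinP <-] [V JV Vf]] VU].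
have [L Lsub VL] := QfinP _ JV.
suff [N [oN cN Nf NV]] : exists N : set {ptws X -> F},
    [/\ open N, convex_set N, N f & N `<=` \bigcap_(M in [set` L]) M].
  by exists N => // g /NV; rewrite VL => Vg; apply: VU; exists V.
have {}Vf : forall M, M \in L -> M f by rewrite -VL in Vf.
have {}Lsub : forall M, M \in L -> exists i (W : set F), open W /\ M = (fun f => f i) @^-1` W.
  by move=> M /Lsub /set_mem [i _] [W oW <-]; exists i, W.
clear VU JV VL QfinP V.
suff H (l : seq (set {ptws X -> F})) : {subset l <= L} -> 
   exists N : set {ptws X -> F},
    [/\ open N, convex_set N, N f & N `<=` \bigcap_(M in [set` l]) M].
  have [N [? ? ? NL]] := H (enum_fset L) (fun _ h => h).
  by exists N; split.
elim: l => [_|M l IH Ml].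
  by exists setT; split=> [|x y t _ _||]; [exact: openT|exact: mem_set|done|done].
have [N [oN cN Nf NV]] := IH (fun x h => Ml x (@mem_behead _ (M :: l) x h)).
have ML : M \in L by apply: Ml; rewrite mem_head.
have [i [W [oW MW]]] := Lsub _ ML.
have Wfi : W (f i) by have := Vf _ ML; rewrite MW.
have [b [Bb1 bfi] bW] := Bb (f i) W (open_nbhs_nbhs (conj oW Wfi)).
exists ((fun f => f i) @^-1` b `&` N); split.
- apply: openI => //; have /continuousP := @proj_cts i; apply; exact: Bo.
- move=> x y t /set_mem[xb xN] /set_mem[yb yN]; apply: mem_set; split.
    have := Bconv b (mem_set Bb1) (x i) (y i) t (mem_set xb) (mem_set yb).
    by move/set_mem.
  by apply/set_mem/cN; exact: mem_set.
- by split.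
move=> g [gb gN] M' /=; rewrite inE => /orP[/eqP ->|M'l]; last exact: NV.
by rewrite MW; exact: bW.
Qed.

HB.instance Definition _ :=
  PreTopologicalNmodule_isTopologicalNmodule.Build {ptws X -> F} ptws_add_continuous.
HB.instance Definition _ :=
  TopologicalNmodule_isTopologicalLmodule.Build K {ptws X -> F} ptws_scale_continuous.
HB.instance Definition _ :=
  Uniform_isTvs.Build K {ptws X -> F} ptws_locally_convex.
End PtwsTvs.


Section Complexification.
Context (R : realType) (E : tvsType R).

(* The pair (x, y) stands for x + iy. *)
Definition complexification : Type := (E * E)%type.
HB.instance Definition _ := Uniform.copy complexification (E * E)%type.
HB.instance Definition _ := GRing.Zmodule.copy complexification (E * E)%type.

Definition complexification_scale (z : R[i]) (w : complexification) :
    complexification :=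
  (complex.Re z *: w.1 - complex.Im z *: w.2,
   complex.Re z *: w.2 + complex.Im z *: w.1).

Let scaleA a b w :
  complexification_scale a (complexification_scale b w) =
  complexification_scale (a * b) w.
Proof.
case: a b w => [a a'] [b b'] [x y]; rewrite /complexification_scale /=.
congr (_, _); rewrite !(scalerBr, scalerDr) !(scalerBl, scalerDl) !scalerA.
  by rewrite !opprD [X in _ + X]addrC addrACA.
by rewrite [X in _ + X]addrC addrACA.
Qed.

Let scale1 : left_id 1 complexification_scale.
Proof.
by move=> [x y]; rewrite /complexification_scale /= !scale1r !scale0r subr0 addr0.
Qed.

Let scaleDr : right_distributive complexification_scale +%R.
Proof.
move=> a [x y] [x' y']; rewrite /complexification_scale /=.
by congr (_, _); rewrite /= !scalerDr ?opprD addrACA.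
Qed.

Let scaleDl v : {morph complexification_scale^~ v : a b / a + b}.
Proof.
case: v => x y [a a'] [b b']; rewrite /complexification_scale /=.
by congr (_, _); rewrite /= !scalerDl ?opprD addrACA.
Qed.

HB.instance Definition _ := GRing.Zmodule_isLmodule.Build R[i] complexification
  scaleA scale1 scaleDr scaleDl.

Let add_cts : continuous (fun x : complexification * complexification => x.1 + x.2).
Proof. exact: (@add_continuous (E * E)%type). Qed.

Let Re_cts : continuous (@complex.Re R : R[i]^o -> R^o).
Proof.
move=> z; apply/(@cvgrPdist_lt _ R^o _ (nbhs (z : R[i]^o)) _ _ _) => e e0; apply/nbhs_ballP.
exists (e%:C)%C; first by rewrite /= ltcR.
move=> w; rewrite -ball_normE /= => h; rewrite -ltcR; apply: le_lt_trans h.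
rewrite -raddfB; exact: normc_ge_Re.
Qed.

Let Im_cts : continuous (@complex.Im R : R[i]^o -> R^o).
Proof.
move=> z; apply/(@cvgrPdist_lt _ R^o _ (nbhs (z : R[i]^o)) _ _ _) => e e0; apply/nbhs_ballP.
exists (e%:C)%C; first by rewrite /= ltcR.
move=> w; rewrite -ball_normE /= => h; rewrite -ltcR; apply: le_lt_trans h.
rewrite -raddfB /=.
have -> : complex.Im (z - w) = - complex.Re ((z - w) * 'i%C) by rewrite ReiNIm opprK.
rewrite normrN (le_trans (normc_ge_Re _))// normrM.
by rewrite [X in _ * X]normc_def /= expr0n expr1n add0r sqrtr1 mulr1.
Qed.

Let scale_cts : continuous (fun z : R[i]^o * complexification => z.1 *: z.2).
Proof.
have cf (f : R[i]^o -> R^o) (p : E * E -> E) : continuous f -> continuous p ->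
    continuous (fun z : R[i]^o * (E * E) => f z.1 *: p z.2).
  move=> cf cp [z w].
  have H := @scale_continuous R E (f z, p w).
  apply: (cvg_comp (fun q : R[i]^o * (E * E) => (f q.1, p q.2)) _ _ H).
  apply: (@cvg_pair _ _ _ _ (nbhs (f z : R^o)) (nbhs (p w : E))) => /=.
    by apply: (cvg_comp fst f); [exact: cvg_fst|exact: cf].
  by apply: (cvg_comp snd p); [exact: cvg_snd|exact: cp].
have c1 : continuous (fst : E * E -> E) by move=> x; exact: cvg_fst.
have c2 : continuous (snd : E * E -> E) by move=> x; exact: cvg_snd.
have addc (g h : R[i]^o * (E * E) -> E) : continuous g -> continuous h ->
    continuous (fun z => g z + h z).
  move=> cg ch z; have H := @add_continuous E (g z, h z).
  apply: (cvg_comp (fun q => (g q, h q)) _ _ H).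
  by apply: cvg_pair => /=; [exact: cg|exact: ch].
have nImc : continuous (fun z : R[i]^o => - complex.Im z : R^o).
  move=> z; apply: (cvg_comp (@complex.Im R : R[i]^o -> R^o) -%R (@Im_cts z)).
  exact: (@opp_continuous R^o).
pose g1 (z : R[i]^o * (E * E)) : E :=
  complex.Re z.1 *: z.2.1 + - complex.Im z.1 *: z.2.2.
pose g2 (z : R[i]^o * (E * E)) : E :=
  complex.Re z.1 *: z.2.2 + complex.Im z.1 *: z.2.1.
have gc : continuous (fun z => (g1 z, g2 z)).
  move=> z; apply: cvg_pair => /=.
    exact: addc _ _ (cf _ _ Re_cts c1) (cf _ _ nImc c2) z.
  exact: addc _ _ (cf _ _ Re_cts c2) (cf _ _ Im_cts c1) z.
have -> : (fun z => z.1 *: z.2) =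
    ((fun z => (g1 z, g2 z)) : R[i]^o * complexification -> complexification).
  by apply/funext => -[z [x y]]; rewrite /g1 scaleNr.
exact: gc.
Qed.

Let lconvex : exists2 B : set_system complexification,
  (forall b, b \in B -> convex_set b) & basis B.
Proof.
have [B Bconv Bbasis] := @locally_convex R (E * E)%type.
exists B => // b bB x y t xb yb.
have t0 : 0 <= t%:num by [].
have t1 : t%:num <= 1 by [].
have [h0 h1 tE] : [/\ 0 <= complex.Re t%:num, complex.Re t%:num <= 1 &
    complex.Im t%:num = 0].
  by move: t0 t1; rewrite !lecE /= => /andP[/eqP -> ->] /andP[_ ->].
have /set_mem bxy := Bconv b bB x y (Itv01 h0 h1) xb yb.
apply: mem_set; move: bxy; congr b.
rewrite /conv/= /unstable.onem; case: x {xb} y {yb} => [x x'] [y y'].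
set s := t%:num in tE *; have -> : s = (complex.Re s)%:C%C.
  by rewrite [LHS]complexE tE mulr0 addr0.
set r := complex.Re s.
have -> : 1 - r%:C%C = (1 - r)%:C%C by rewrite rmorphB rmorph1.
rewrite [RHS]/(complexification_scale r%:C%C (x, x') +
  complexification_scale (1 - r)%:C%C (y, y')).
by rewrite /complexification_scale /= !scale0r !subr0 !addr0.
Qed.

HB.instance Definition _ :=
  PreTopologicalNmodule_isTopologicalNmodule.Build complexification add_cts.
HB.instance Definition _ :=
  TopologicalNmodule_isTopologicalLmodule.Build R[i] complexification scale_cts.
HB.instance Definition _ := Uniform_isTvs.Build R[i] complexification lconvex.

End Complexification.

Section BastianiCalculus.
Context {K : numFieldType} {E F : tvsType K}.
Implicit Types (f : E -> F) (U : set E) (x v : E).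

Definition difference_quotient f x v (h : K^o) : F :=
  h^-1 *: (f (x + h *: v) - f x).

Definition is_dir_derivative f v x (l : F) : Prop :=
  difference_quotient f x v @ (0 : K^o)^' --> l.

Definition has_dir_derivative f v x : Prop :=
  exists l, is_dir_derivative f v x l.

(* Junk value 0 where the derivative does not exist. *)
Definition dir_derivative f v : E -> F :=
  fun x => xget 0 [set l | is_dir_derivative f v x l].

(* [iter_dir_derivative f [:: y_1; ...; y_k]] is D_{y_k} ... D_{y_1} f. *)
Definition iter_dir_derivative f (ys : seq E) : E -> F :=
  foldl dir_derivative f ys.

(* Only the values of [f] on the open set [U] matter.  As [U] is open,
   continuity of d^(k) f on U x E^k is continuity at each of its points. *)
Definition bastiani_C (r : nat) U f : Prop :=
  [/\ open U,
      forall ys v x, (size ys < r)%N -> U x ->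
        has_dir_derivative (iter_dir_derivative f ys) v x &
      forall k, (k <= r)%N -> forall x (y : {ptws 'I_k -> E}), U x ->
        {for (x, y), continuous (fun p : E * {ptws 'I_k -> E} =>
           iter_dir_derivative f [seq p.2 i | i <- enum 'I_k] p.1)}].

Definition bastiani_smooth U f : Prop := forall r, bastiani_C r U f.

End BastianiCalculus.

Section RealAnalytic.
Context {R : realType} {E F : tvsType R}.

Definition holomorphic (V : set (complexification E))
    (g : complexification E -> complexification F) : Prop :=
  bastiani_smooth V g.

Definition real_analytic (U : set E) (f : E -> F) : Prop :=
  open U /\
  exists (V : set (complexification E))
         (g : complexification E -> complexification F),
    holomorphic V g /\
    (forall x, U x -> V (x, 0) /\ g (x, 0) = (f x, 0)).

End RealAnalytic.

Section FrechetSpaces.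
Context {R : realType}.

Definition seminorm (E : lmodType R) (p : E -> R) : Prop :=
  [/\ forall x, 0 <= p x,
      forall x y, p (x + y) <= p x + p y &
      forall c x, p (c *: x) = `|c| * p x].

Definition frechet_space (E : tvsType R) : Prop :=
  hausdorff_space E /\
  exists p : nat -> E -> R,
    [/\ forall n, seminorm (p n),
        forall (x : E) (A : set E), nbhs x A <->
          exists (n : nat) (e : R), 0 < e /\
            forall y, (forall i, (i < n)%N -> p i (y - x) < e) -> A y &
        forall u : nat -> E,
          (forall i (e : R), 0 < e -> exists N : nat, forall m n,
             (N <= m)%N -> (N <= n)%N -> p i (u m - u n) < e) ->
          exists l : E, u @ \oo --> l].

Definition infinite_dimensional (E : lmodType R) : Prop :=
  ~ exists (n : nat) (b : 'I_n -> E),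
      forall x : E, exists c : 'I_n -> R, x = \sum_(i < n) c i *: b i.

End FrechetSpaces.

Section Manifolds.
Context {R : realType}.

Inductive regularity := Smooth | Analytic.

Definition regular (r : regularity) (E F : tvsType R) (U : set E)
    (f : E -> F) : Prop :=
  match r with
  | Smooth => bastiani_smooth U f
  | Analytic => real_analytic U f
  end.

(* [chart_fun] matters only on [chart_dom], [chart_inv] only on its image. *)
Record chart (M : topologicalType) (E : tvsType R) := Chart {
  chart_dom : set M;
  chart_fun : M -> E;
  chart_inv : E -> M
}.

Definition chart_cod M E (c : chart M E) : set E :=
  chart_fun c @` chart_dom c.

Definition is_chart M E (c : chart M E) : Prop :=
  [/\ open (chart_dom c),
      open (chart_cod c),
      forall x, chart_dom c x -> chart_inv c (chart_fun c x) = x,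
      {within chart_dom c, continuous (chart_fun c)} &
      {within chart_cod c, continuous (chart_inv c)}].

Definition is_atlas (r : regularity) M E (A : set (chart M E)) : Prop :=
  [/\ forall c, A c -> is_chart c,
      forall x, exists2 c, A c & chart_dom c x &
      forall c d, A c -> A d ->
        regular r (chart_fun c @` (chart_dom c `&` chart_dom d))
          (chart_fun d \o chart_inv c)].

Definition is_manifold (r : regularity) M E (A : set (chart M E)) : Prop :=
  [/\ hausdorff_space E, hausdorff_space M & is_atlas r A].

Definition prod_chart M E N F (c : chart M E) (d : chart N F) :
    chart (M * N)%type (E * F)%type :=
  Chart (chart_dom c `*` chart_dom d)
        (fun x => (chart_fun c x.1, chart_fun d x.2))
        (fun y => (chart_inv c y.1, chart_inv d y.2)).

Definition prod_atlas M E N F (A : set (chart M E)) (B : set (chart N F)) :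
    set (chart (M * N)%type (E * F)%type) :=
  [set prod_chart c d | c in A & d in B].

Definition regular_map (r : regularity) M E N F (A : set (chart M E))
    (B : set (chart N F)) (f : M -> N) : Prop :=
  continuous f /\
  forall c d, A c -> B d ->
    regular r (chart_fun c @` (chart_dom c `&` f @^-1` chart_dom d))
      (chart_fun d \o f \o chart_inv c).

Definition is_group (G : Type) (mul : G -> G -> G) (inv : G -> G) (one : G) :
    Prop :=
  [/\ associative mul, left_id one mul, right_id one mul,
      left_inverse one inv mul & right_inverse one inv mul].

Definition is_lie_group (r : regularity) (G : topologicalType) (E : tvsType R)
    (A : set (chart G E)) (mul : G -> G -> G) (inv : G -> G) (one : G) : Prop :=
  [/\ is_group mul inv one,
      is_manifold r A,
      regular_map r (prod_atlas A A) A (fun x : G * G => mul x.1 x.2) &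
      regular_map r A A inv].

Definition is_real_analytic_lie_group (G : topologicalType) (E : tvsType R)
    (A : set (chart G E)) (mul : G -> G -> G) (inv : G -> G) (one : G) : Prop :=
  is_lie_group Smooth A mul inv one /\ is_lie_group Analytic A mul inv one.

End Manifolds.

(* A cycle of length 2 runs back and forth along a single edge. *)
Definition is_tree (V : finType) (adj : rel V) : Prop :=
  [/\ symmetric adj, irreflexive adj,
      forall x y, connect adj x y &
      forall c : seq V, ucycle adj c -> (size c <= 2)%N].

Section FiniteTrees.
Context {V : finType}.
Implicit Types (adj : rel V) (s : {set V}).

Definition adj_in adj s : rel V := [rel x y | [&& x \in s, y \in s & adj x y]].

Definition connected_in adj s : bool :=
  [forall x in s, forall y in s, connect (adj_in adj s) x y].

Lemma connected_inP adj s :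
  reflect {in s &, forall x y, connect (adj_in adj s) x y} (connected_in adj s).
Proof.
apply: (iffP forall_inP) => [H x y xs ys|H x xs].
  by have /forall_inP := H x xs; apply.
by apply/forall_inP => y ys; exact: H.
Qed.

(* The subgraph induced on [s], with its vertices renumbered. *)
Definition induced adj s : rel 'I_#|s| :=
  [rel i j | adj (enum_val i) (enum_val j)].
Arguments induced : clear implicits.

Definition component adj s (v : V) : {set V} :=
  [set u | connect (adj_in adj s) v u].

Lemma induced_is_tree adj s :
  is_tree adj -> connected_in adj s -> is_tree (induced adj s).
Proof.
move=> [adjC adjI _ adjA] /connected_inP sC.
have tr (x y : V) (xs : x \in s) p : path (adj_in adj s) x p -> y = last x p ->
    forall i j, enum_val i = x -> enum_val j = y -> connect (induced adj s) i j.
  elim: p x xs => [|z p IH] x xs /=.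
    by move=> _ -> i j ix jx; rewrite (enum_val_inj (etrans ix (esym jx))).
  case/andP => /and3P[_ zs xz] pz yl i j ix jy.
  apply: (@connect_trans _ _ (enum_rank_in zs z)).
    by apply: connect1; rewrite /induced /= ix enum_rankK_in.
  by apply: (IH z zs pz yl); rewrite ?enum_rankK_in.
split.
- by move=> i j; exact: adjC.
- by move=> i; exact: adjI.
- move=> i j.
  have /connectP [p pp yl] := sC _ _ (enum_valP i) (enum_valP j).
  exact: (tr _ _ (enum_valP i) p pp yl).
- move=> c /andP[cc uc].
  rewrite -(size_map (@enum_val _ (mem s))); apply: adjA; apply/andP; split.
    by rewrite cycle_map.
  by rewrite map_inj_uniq //; exact: enum_val_inj.
Qed.

Lemma connected_component adj s v :
  symmetric adj -> connected_in adj (component adj s v).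
Proof.
move=> adjC; have symS : symmetric (adj_in adj s).
  by move=> x y; rewrite /adj_in /= adjC andbCA.
have cS := sym_connect_sym symS.
have H u : u \in component adj s v ->
    connect (adj_in adj (component adj s v)) v u.
  rewrite inE => /connectP [p pp ->].
  have vv : v \in component adj s v by rewrite inE connect0.
  elim: p {1 3 5 6}v vv pp => [|z p IH] w wv /=; first by rewrite connect0.
  case/andP => wz pz.
  have zv : z \in component adj s v.
    by move: wv; rewrite !inE => wv; exact: connect_trans wv (connect1 wz).
  apply: connect_trans (IH z zv pz); apply: connect1.
  by rewrite /adj_in /= wv zv; case/and3P: wz.
apply/connected_inP => x y xv yv.
apply: connect_trans (H y yv).
rewrite sym_connect_sym ?H// => a b.
by rewrite /adj_in /= adjC andbCA.
Qed.

End FiniteTrees.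

Record rooted_tree := RootedTree {
  tree_order : nat;
  tree_adj : 'I_tree_order -> 'I_tree_order -> bool;
  tree_root : 'I_tree_order;
  tree_is_tree : is_tree tree_adj
}.

HB.instance Definition _ := gen_eqMixin rooted_tree.
HB.instance Definition _ := gen_choiceMixin rooted_tree.

Definition rooted_iso (t u : rooted_tree) : Prop :=
  exists f : 'I_(tree_order t) -> 'I_(tree_order u),
    [/\ bijective f, f (tree_root t) = tree_root u &
        forall x y, tree_adj (f x) (f y) = tree_adj x y].

Definition rooted_isob : rel rooted_tree := fun t u => `[< rooted_iso t u >].

Lemma rooted_iso_equiv : equiv_class_of rooted_isob.
Proof.
split.
- move=> t; apply/asboolP; exists id; split => //; by exists id.
- suff H t u : rooted_iso t u -> rooted_iso u t.
    by move=> t u; apply/asboolP/asboolP; exact: H.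
  move=> [f [[g fK gK] fr fa]]; exists g; split; first by exists f.
    by rewrite -fr fK.
  by move=> x y; rewrite -fa !gK.
- move=> u t w /asboolP [f [fb fr fa]] /asboolP [g [gb gr ga]].
  apply/asboolP; exists (g \o f); split; first exact: bij_comp.
    by rewrite /= fr.
  by move=> x y /=; rewrite ga fa.
Qed.

Canonical rooted_iso_equiv_rel := EquivRelPack rooted_iso_equiv.

(* The set of rooted trees up to root-preserving isomorphism; [option tree]
   adjoins the empty tree as [None]. *)
Definition tree := {eq_quot rooted_isob}%qT.
HB.instance Definition _ := Choice.on tree.
HB.instance Definition _ : EqQuotient _ rooted_isob tree := EqQuotient.on tree.

Section OrderedSubtrees.
Variable t : rooted_tree.
Implicit Types (s : {set 'I_(tree_order t)}) (v : 'I_(tree_order t)).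

Definition ordered_subtrees : {set {set 'I_(tree_order t)}} :=
  [set s | connected_in (@tree_adj t) s &&
     ((s != finset.set0) ==> (tree_root t \in s))].

Definition induced_tree s v (vs : v \in s) (sC : connected_in (@tree_adj t) s) :
    rooted_tree :=
  RootedTree (enum_rank_in vs v) (induced_is_tree (tree_is_tree t) sC).

(* For s in [ordered_subtrees], the case [None] occurs exactly when s is
   empty. *)
Definition subtree s : option tree :=
  match pselect (tree_root t \in s /\ connected_in (@tree_adj t) s) with
  | left (conj rs sC) => Some (\pi_tree (induced_tree rs sC))%qT
  | right _ => None
  end.

Lemma mem_component s v : v \in component (@tree_adj t) (finset.setC s) v.
Proof. by rewrite inE connect0. Qed.

Lemma connected_branch s v :
  connected_in (@tree_adj t) (component (@tree_adj t) (finset.setC s) v).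
Proof. by apply: connected_component; case: (tree_is_tree t). Qed.

(* The component of [v] in the complement of [s], rooted at [v]. *)
Definition branch s v : rooted_tree :=
  induced_tree (mem_component s v) (connected_branch s v).

(* The vertices outside [s] that are closest to the root of [t] in their
   component of the complement of [s]. *)
Definition branch_roots s : {set 'I_(tree_order t)} :=
  [set v | (v \notin s) &&
     ((v == tree_root t) || [exists u, (u \in s) && tree_adj u v])].

Definition forest_complement s : seq tree :=
  [seq (\pi_tree (branch s v))%qT | v <- enum (branch_roots s)].

End OrderedSubtrees.

Section ButcherGroup.
Variable R : realType.

Definition butcher_set : set {ptws option tree -> R^o} :=
  [set a | a None = 1].

(* Topologized as a subspace of R^(T_0). *)
Definition butcher_group : topologicalType := set_type butcher_set.

Implicit Types a b : butcher_group.

(* The formula is invariant under isomorphism, so [repr] may pick any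
   representative; the only ordered subtree of the empty tree is empty. *)
Definition butcher_mul_fun a b : {ptws option tree -> R^o} := fun tau =>
  match tau with
  | None => set_val b None
  | Some theta =>
    let t := repr theta in
    \sum_(s in ordered_subtrees t)
      set_val b (subtree s) *
      \prod_(u <- forest_complement s) set_val a (Some u)
  end.

Lemma butcher_mul_subproof a b : butcher_mul_fun a b \in butcher_set.
Proof. by apply: mem_set; exact: set_valP b. Qed.

Definition butcher_mul a b : butcher_group :=
  exist _ (butcher_mul_fun a b) (butcher_mul_subproof a b).

Definition butcher_one_fun : {ptws option tree -> R^o} :=
  fun tau => if tau is Some _ then 0 else 1.

Lemma butcher_one_subproof : butcher_one_fun \in butcher_set.
Proof. exact: mem_set. Qed.

Definition butcher_one : butcher_group :=
  exist _ butcher_one_fun butcher_one_subproof.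

(* [x : R^T] is extended to T_0 by the value 0 at the empty tree. *)
Definition butcher_of_fun (x : {ptws tree -> R^o}) :
    {ptws option tree -> R^o} :=
  fun tau => butcher_one_fun tau + (if tau is Some theta then x theta else 0).

Lemma butcher_of_subproof x : butcher_of_fun x \in butcher_set.
Proof. by apply: mem_set; rewrite /butcher_set /butcher_of_fun /= addr0. Qed.

Definition butcher_of x : butcher_group :=
  exist _ (butcher_of_fun x) (butcher_of_subproof x).

Definition butcher_chart : chart butcher_group {ptws tree -> R^o} :=
  @Chart R butcher_group {ptws tree -> R^o} setT
    (fun a theta => set_val a (Some theta) - set_val butcher_one (Some theta))
    butcher_of.

End ButcherGroup.

(* Main.v *)
(* A connected acyclic graph with a root carries a parent function, because each
   edge is a bridge.  Write desc v for the descendants of v.  The ordered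
   subtrees of a rooted tree are then the parent-closed vertex sets s, and the
   forest left after removing s consists of the sets desc v, for v outside s
   with parent in s.  Hence, for fixed s, an ordered subtree w containing s is
   the same thing as a family of ordered subtrees of these branches, via
   w |-> (w :&: desc v)_v; expanding a product of sums over the branches
   according to this bijection is exactly the associativity of the Butcher
   product.  A left inverse is obtained by solving for the term s = empty,
   recursively on the number of vertices.

   In the chart, each component of the product and of the inverse is a polynomial
   in finitely many coordinates.  Polynomials in continuous linear forms whose
   coefficients depend continuously on parameters are stable under directional
   derivatives along continuously varying directions, and are jointly continuous;
   this gives Bastiani smoothness over any base field.  The same polynomials
   evaluated on complexified coordinates give the holomorphic extension. *)
Require Import Defs.
From HB Require Import structures.
From mathcomp Require Import all_boot all_order all_algebra generic_quotient.
From mathcomp Require Import all_classical all_reals all_analysis.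
From mathcomp Require Import complex ring.

Set Implicit Arguments.
Unset Strict Implicit.
Unset Printing Implicit Defensive.

Import Order.TTheory GRing.Theory Num.Theory.

Local Open Scope ring_scope.

(** * The parent function of a rooted tree *)

Section TreeStructure.
Context {V : finType} {adj : rel V}.
Hypothesis tadj : is_tree adj.

Let adjC : symmetric adj. Proof. by case: tadj. Qed.

(** A path avoiding the edge, shortened to a simple one, closes up with that edge to a simple cycle.
    Acyclicity bounds the cycle by two vertices, so the path would be trivial or the removed edge
    itself. *)
Lemma tree_edge_bridge x y : adj x y ->
  ~~ connect [rel a b | adj a b && ~~ [|| (a == x) && (b == y) | (a == y) && (b == x)]] x y.
Proof.
move=> xy; apply/negP => /connectP [p0 pp0 yl].
case/shortenP: pp0 yl => p pp up _ yl.
have [_ adjI _ adjA] := tadj.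
have pa : path adj x p.
  by apply: sub_path pp => a b /andP[].
have := adjA (x :: p); rewrite /ucycle up andbT /= rcons_path pa /= -yl adjC xy.
move=> /(_ isT); case: p pp up yl {pa} => [|z [|w p]] //= pp up yl.
  by move: xy; rewrite yl adjI.
by move=> _; move: pp; rewrite -yl !eqxx /= andbF.
Qed.

(** [d] is the distance to [r], and [par] picks a neighbour strictly closer to [r]. If an edge were
    not a parent edge, both its ends would still reach [r] along parent edges after its removal, so
    it would not be a bridge. *)
Lemma tree_parent_exists (r : V) : exists (par : V -> V) (d : V -> nat),
  [/\ par r = r,
      forall x, x != r -> (d (par x) < d x)%N &
      forall x y, adj x y = [|| (x != r) && (y == par x) | (y != r) && (x == par y)]].
Proof.
have [_ adjI adjc _] := tadj.
pose P x n := `[< exists p, [/\ path adj r p, x = last r p & size p = n] >].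
have exP x : exists n, P x n.
  have /connectP[p pp xl] := adjc r x.
  by exists (size p); apply/asboolP; exists p.
pose d x := ex_minn (exP x).
have step x : x != r -> exists y, adj x y && (d y < d x)%N.
  move=> xr; rewrite {2}/d; case: ex_minnP => n /asboolP [p [pp xl sz]] _.
  case/lastP: p pp xl sz => [|p z]; first by move=> _ xE; rewrite xE eqxx in xr.
  rewrite rcons_path last_rcons size_rcons => /andP[pp lz] xz <-.
  exists (last r p); rewrite adjC xz lz /= ltnS /d; case: ex_minnP => m _; apply.
  by apply/asboolP; exists p.
pose par x := if x == r then r else odflt x [pick y | adj x y && (d y < d x)%N].
have parP x : x != r -> adj x (par x) && (d (par x) < d x)%N.
  move=> xr; rewrite /par (negbTE xr); case: pickP => [y //|none].
  by have [y] := step x xr; rewrite none.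
exists par, d; split.
- by rewrite /par eqxx.
- by move=> x /parP /andP[].
move=> x y; apply/idP/idP; last first.
  case/orP => /andP[h /eqP ->]; first by case/andP: (parP _ h).
  by rewrite adjC; case/andP: (parP _ h).
move=> xy; apply: contraT; rewrite negb_or => /andP[nx ny].
pose e := [rel a b | adj a b && ~~ [|| (a == x) && (b == y) | (a == y) && (b == x)]].
have es : symmetric e.
  move=> a b; rewrite /e /= adjC; congr (_ && ~~ _).
  by rewrite orbC andbC [in X in _ || X]andbC.
have cr z : connect e z r.
  have [n] := ubnP (d z); elim: n z => // n IH z zn.
  have [->|zr] := eqVneq z r; first exact: connect0.
  have /andP[za zd] := parP z zr.
  apply: (@connect_trans _ _ (par z)); last by apply: IH; exact: leq_trans zd zn.
  apply: connect1; rewrite /e /= za negb_or /=.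
  apply/andP; split; apply/negP => /andP[/eqP zx /eqP py].
    by move: nx; rewrite -zx zr -py eqxx.
  by move: ny; rewrite -zx zr -py eqxx.
have /negP := tree_edge_bridge xy; case.
apply: connect_trans (cr x) _; rewrite sym_connect_sym //; exact: cr.
Qed.

End TreeStructure.

(** * Descendants, lower sets and their boundaries *)

Section Parents.
Context {V : finType} {adj : rel V} {r : V} {par : V -> V} {d : V -> nat}.
Hypothesis par_root : par r = r.
Hypothesis par_lt : forall x, x != r -> (d (par x) < d x)%N.
Hypothesis adjE : forall x y,
  adj x y = [|| (x != r) && (y == par x) | (y != r) && (x == par y)].
Implicit Types (A B s w : {set V}) (u v x y : V).
Local Open Scope set_scope.

(** The full subtree hanging from [v], with [v] included: the vertices that have [v] as an iterated
    parent. *)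
Definition desc v : {set V} := [set y | fconnect par y v].

Lemma desc_refl v : v \in desc v. Proof. by rewrite inE connect0. Qed.

Lemma desc_par v y : y \in desc v -> y = v \/ par y \in desc v.
Proof.
rewrite !inE => /connectP [[|z p] /= pp ->]; first by left.
by case/andP: pp => /eqP zE pp; right; apply/connectP; exists p; rewrite zE.
Qed.

Lemma par_desc v y : par y \in desc v -> y \in desc v.
Proof.
rewrite !inE; apply: connect_trans; exact: fconnect1.
Qed.

Lemma desc_trans u v y : u \in desc v -> y \in desc u -> y \in desc v.
Proof. rewrite !inE => uv yu; exact: connect_trans yu uv. Qed.

Lemma desc_root y : y \in desc r.
Proof.
have [n] := ubnP (d y); elim: n y => // n IH y yn.
have [->|yr] := eqVneq y r; first exact: desc_refl.
by apply: par_desc; apply: IH; exact: leq_trans (par_lt yr) yn.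
Qed.

Lemma desc_rootE y : r \in desc y -> y = r.
Proof.
rewrite inE => /connectP [p pp ->].
by elim: p pp => //= z p IH /andP[/eqP <-]; rewrite par_root.
Qed.

Lemma desc_lt v y : y \in desc v -> y != v -> (d v < d y)%N.
Proof.
have [n] := ubnP (d y); elim: n y => // n IH y yn yv nyv.
have yr : y != r.
  by apply: contraNneq nyv => yr; move: yv; rewrite yr => /desc_rootE ->.
have := par_lt yr; case: (desc_par yv) => [yE|]; first by rewrite yE eqxx in nyv.
have [<-//|pv] := eqVneq (par y) v.
move=> py lt; apply: (ltn_trans _ lt); apply: (IH (par y)) => //; exact: leq_trans lt yn.
Qed.

Lemma desc_anti u v : u \in desc v -> v \in desc u -> u = v.
Proof.
move=> uv vu; apply/eqP/contraT => nuv.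
have nvu : v != u by rewrite eq_sym.
by have := ltn_trans (desc_lt uv nuv) (desc_lt vu nvu); rewrite ltnn.
Qed.

(** The iterated parents of [y] form a chain: whichever of [u] and [v] is met first on the way up
    descends from the other. *)
Lemma desc_total u v y : y \in desc u -> y \in desc v ->
  u \in desc v \/ v \in desc u.
Proof.
have [n] := ubnP (d y); elim: n y => // n IH y yn yu yv.
case: (desc_par yu) => [<-|pu]; first by left.
case: (desc_par yv) => [<-|pv]; first by right.
have [yr|yr] := eqVneq y r; last by apply: (IH (par y)) => //; exact: leq_trans (par_lt yr) yn.
left; rewrite (_ : u = v) ?desc_refl//.
by move: yu yv; rewrite yr => /desc_rootE -> /desc_rootE ->.
Qed.

(* [A] is connected with topmost vertex [v]. *)
Definition rooted_at A v :=
  (v \in A) && [forall x in A, (x == v) || (x != r) && (par x \in A)].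

Lemma rooted_atP A v : reflect
  (v \in A /\ forall x, x \in A -> x != v -> x != r /\ par x \in A)
  (rooted_at A v).
Proof.
apply: (iffP andP) => -[vA]; first move/forall_inP => H; last move=> H; split => //.
  by move=> x xA xv; have := H x xA; rewrite (negbTE xv) /= => /andP[].
apply/forall_inP => x xA; have [//|xv] := eqVneq x v.
by apply/andP; exact: H.
Qed.

Lemma rooted_at_desc A v x : rooted_at A v -> x \in A -> x \in desc v.
Proof.
move=> /rooted_atP [vA H].
have [n] := ubnP (d x); elim: n x => // n IH x xn xA.
have [->|xv] := eqVneq x v; first exact: desc_refl.
have [xr pA] := H x xA xv; apply: par_desc; apply: IH => //.
by exact: leq_trans (par_lt xr) xn.
Qed.

Lemma adj_parP x y : adj x y -> (x != r /\ y = par x) \/ (y != r /\ x = par y).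
Proof. by rewrite adjE => /orP[] /andP[? /eqP]; [left|right]. Qed.

Lemma adj_sym : symmetric adj.
Proof. by move=> x y; rewrite !adjE orbC. Qed.

Lemma adj_in_sym A : symmetric (adj_in adj A).
Proof. by move=> x y; rewrite /adj_in /= adj_sym andbCA. Qed.

Lemma connect_in_par A x : x \in A -> x != r -> par x \in A ->
  connect (adj_in adj A) x (par x).
Proof.
move=> xA xr pA; apply: connect1.
by rewrite /adj_in /= xA pA adjE xr eqxx.
Qed.

Lemma rooted_at_connected A v : rooted_at A v -> connected_in adj A.
Proof.
move=> /rooted_atP [vA H].
have cv x : x \in A -> connect (adj_in adj A) x v.
  have [n] := ubnP (d x); elim: n x => // n IH x xn xA.
  have [->|xv] := eqVneq x v; first exact: connect0.
  have [xr pA] := H x xA xv; apply: connect_trans (connect_in_par xA xr pA) _.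
  by apply: IH => //; exact: leq_trans (par_lt xr) xn.
apply/connected_inP => x y xA yA; apply: connect_trans (cv x xA) _.
by rewrite sym_connect_sym; [exact: cv|exact: adj_in_sym].
Qed.

(** The only edge leaving [desc x] joins [x] to its parent, and that parent is outside [B]. *)
Lemma connect_in_desc B x y : (x != r -> par x \notin B) ->
  connect (adj_in adj B) x y -> y \in desc x.
Proof.
move=> px /connectP [p pp ->]; move: (desc_refl x) pp.
elim: p {1 3 4}x => //= z p IH u ux /andP[/and3P[uB zB /adj_parP uz] pp].
apply: IH pp; case: uz => -[nr E].
  case: (desc_par ux) => [ux'|]; last by rewrite E.
  by move: (px); rewrite -ux' nr -E zB => /(_ isT).
by apply: par_desc; rewrite -E.
Qed.

(** If [x] in [s] had its parent outside [s], the path in [s] from [x] to [v] would stay below [x];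
    then [x] and [v] descend from each other and coincide. *)
Lemma connected_rooted_at A v s : rooted_at A v -> s \subset A -> v \in s ->
  connected_in adj s = rooted_at s v.
Proof.
move=> Av sA vs; apply/idP/idP; last exact: rooted_at_connected.
move=> /connected_inP sc; apply/rooted_atP; split=> // x xs xv.
have xA := fintype.subsetP sA _ xs.
have /rooted_atP [_ /(_ x xA xv) [xr pA]] := Av; split => //.
apply: contraT => px.
have vx : v \in desc x by apply: (connect_in_desc (B := s)) (sc _ _ xs vs).
by rewrite (desc_anti (rooted_at_desc Av xA) vx) eqxx in xv.
Qed.

(* [v] is meant to be the top of a set containing [s]; its parent is ignored. *)
Definition lower v s := [forall x in s, (x == v) || (par x \in s)].

Lemma lowerP v s : reflect (forall x, x \in s -> x != v -> par x \in s) (lower v s).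
Proof.
apply: (iffP forall_inP) => H x xs.
  by move=> xv; have := H x xs; rewrite (negbTE xv).
by have [//|xv] := eqVneq x v; exact: H.
Qed.

(** Climbing from [x] to [u] stays in [s], since the exceptional vertex [v] is not passed strictly
    below [u]. *)
Lemma lower_ancestor v s x u : lower v s -> x \in s -> x \in desc u ->
  u \in desc v -> u \in s.
Proof.
move=> /lowerP sl; have [n] := ubnP (d x); elim: n x => // n IH x xn xs xu uv.
have [<-//|nxu] := eqVneq x u.
have xv : x != v.
  apply: contra_neq nxu => xv; rewrite xv in xu *; exact: desc_anti.
have xr : x != r.
  by apply: contra_neq nxu => E; rewrite E in xu *; rewrite (desc_rootE xu).
case: (desc_par xu) => [E|pu]; first by rewrite E eqxx in nxu.
by apply: (IH (par x)) => //; [exact: leq_trans (par_lt xr) xn|exact: sl].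
Qed.

(** Translates the graph-theoretic notion of ordered subtree, including the empty one, into closure
    under parents. *)
Lemma lower_ordered A v s : rooted_at A v -> s \subset A ->
  connected_in adj s && ((s != finset.set0) ==> (v \in s)) = lower v s.
Proof.
move=> Av sA; have [->|sn0] := eqVneq s finset.set0.
  rewrite /= andbT; apply/idP/idP => _.
    by apply/lowerP => x; rewrite finset.in_set0.
  by apply/connected_inP => x y; rewrite finset.in_set0.
rewrite /=; apply/andP/idP => [[sc vs]|sl].
  move: sc; rewrite (connected_rooted_at Av sA vs) => /rooted_atP [_ H].
  by apply/lowerP => x xs xv; case: (H x xs xv).
have vs : v \in s.
  have /set0Pn [x xs] := sn0.
  apply: (lower_ancestor sl xs _ (desc_refl v)).
  exact: rooted_at_desc Av (fintype.subsetP sA _ xs).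
split=> //; rewrite (connected_rooted_at Av sA vs); apply/rooted_atP; split => //.
move=> x xs xv; have xA := fintype.subsetP sA _ xs.
have /rooted_atP [_ /(_ x xA xv) [xr _]] := Av; split => //.
by move/lowerP: sl; apply.
Qed.

(* The roots of the forest left after removing [s] from [A]. *)
Definition boundary A v s : {set V} :=
  [set u in A :\: s | (u == v) || (par u \in s)].

(** A neighbour in [s] of a vertex [u] outside [s] has to be the parent of [u]: a child of [u] lying
    in [s] would force [u] into [s]. *)
Lemma boundaryE A v s : rooted_at A v -> s \subset A -> lower v s ->
  boundary A v s =
  [set u in A :\: s | (u == v) || [exists x, (x \in s) && adj x u]].
Proof.
move=> Av sA sl; apply/finset.setP => u; rewrite !inE.
case uA : (u \in A); rewrite ?andbF// andbT.
case us : (u \in s) => //=; have [//|uv /=] := eqVneq u v.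
have /rooted_atP [vA /(_ u uA uv) [ur pA]] := Av.
apply/idP/existsP => [pu|[x /andP[xs /adj_parP [] [nr E]]]].
- by exists (par u); rewrite pu adjE ur eqxx orbT.
- have [xv|xv] := eqVneq x v; last first.
    by move/lowerP: sl => /(_ x xs xv); rewrite -E us.
  have ud := rooted_at_desc Av uA.
  have := par_lt nr; rewrite -E xv => ltu.
  by have := ltn_trans ltu (desc_lt ud uv); rewrite ltnn.
- by rewrite -E.
Qed.

Lemma boundary_disjoint A v s u y : rooted_at A v -> s \subset A ->
  lower v s -> u \in boundary A v s -> y \in desc u -> y \notin s.
Proof.
move=> Av sA sl + yu; rewrite !inE => /andP[/andP[us uA] _].
apply: contra us => ys; apply: lower_ancestor sl ys yu _.
exact: rooted_at_desc Av uA.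
Qed.

(** A path in the complement cannot leave [desc u], because the parent of [u] lies in [s] or outside
    [A]. Conversely, climbing from a descendant of [u] up to [u] never meets the lower set [s]. *)
Lemma boundary_component A v s u : rooted_at A v -> s \subset A ->
  lower v s -> u \in boundary A v s ->
  component adj (A :\: s) u = A :&: desc u.
Proof.
move=> Av sA sl ub; have := ub; rewrite !inE => /andP[/andP[us uA] pu].
have /rooted_atP [vA AH] := Av.
have uv := rooted_at_desc Av uA.
apply/finset.setP => y; rewrite inE; apply/idP/idP => [c|].
  rewrite inE (connect_in_desc _ c) ?andbT.
    case/connectP: c => p pp ->; move: uA pp.
    elim: p {1 2 3}u => //= z p IH x xA /andP[/and3P[_ + _] pp].
    by rewrite !inE => /andP[_ zA]; exact: IH.
  move=> ur; rewrite inE negb_and negbK.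
  have [uE|nuv] := eqVneq u v; last first.
    by move: pu; rewrite (negbTE nuv) /= => ->.
  apply/orP; right; apply/negP => /(rooted_at_desc Av) pv.
  have [E|npv] := eqVneq (par u) v.
    by have := par_lt ur; rewrite E uE ltnn.
  have := leq_trans (desc_lt pv npv) (ltnW (par_lt ur)).
  by rewrite uE ltnn.
rewrite inE => /andP[yA yu].
have yns := boundary_disjoint Av sA sl ub yu.
rewrite sym_connect_sym; last exact: adj_in_sym.
have [n] := ubnP (d y); elim: n y yA yu yns => // n IH y yA yu yns yn.
have [->|nyu] := eqVneq y u; first exact: connect0.
case: (desc_par yu) => [E|pyu]; first by rewrite E eqxx in nyu.
have yv : y != v.
  apply: contra_neq nyu => E; rewrite E in yu *; exact: desc_anti.
have [yr pyA] := AH y yA yv.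
have pys := boundary_disjoint Av sA sl ub pyu.
apply: (@connect_trans _ _ (par y)).
  by apply: connect_in_par; rewrite // inE ?yns ?pys.
by apply: IH => //; exact: leq_trans (par_lt yr) yn.
Qed.

Lemma rooted_at_inter_desc A v u : rooted_at A v -> u \in A ->
  rooted_at (A :&: desc u) u.
Proof.
move=> Av uA; have /rooted_atP [_ AH] := Av.
apply/rooted_atP; split; first by rewrite inE uA desc_refl.
move=> x; rewrite inE => /andP[xA xu] nxu.
have xv : x != v.
  apply: contra_neq nxu => E; rewrite E in xu *.
  exact: desc_anti (rooted_at_desc Av uA).
have [xr pA] := AH x xA xv; split => //; rewrite inE pA.
by case: (desc_par xu) => // E; rewrite E eqxx in nxu.
Qed.

Lemma rooted_at_setT : rooted_at [set: V] r.
Proof.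
apply/rooted_atP; split; first exact: finset.in_setT.
by move=> x _ xr; rewrite finset.in_setT.
Qed.

Lemma boundary_rootP s u : reflect (u \notin s /\ (u = r \/ par u \in s))
  (u \in boundary [set: V] r s).
Proof.
rewrite !inE andbT; apply: (iffP andP) => -[us].
  by case/orP => [/eqP E|pu]; split=> //; by [left|right].
by case=> E; split=> //; rewrite E ?eqxx ?orbT.
Qed.

Lemma boundary_exists s x : x \notin s ->
  exists2 v, v \in boundary [set: V] r s & x \in desc v.
Proof.
have [n] := ubnP (d x); elim: n x => // n IH x xn xs.
have [xr|xr] := eqVneq x r.
  by exists x; [apply/boundary_rootP; split=> //; left|exact: desc_refl].
case ps : (par x \in s).
  by exists x; [apply/boundary_rootP; split=> //; right|exact: desc_refl].
have [||v vb pv] := IH (par x); first exact: leq_trans (par_lt xr) xn.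
  by rewrite ps.
by exists v => //; exact: par_desc.
Qed.

(** Two such roots are comparable. If [u] were strictly below [v], the parent of [u], which lies in
    [s], would be below [v] and would pull [v] into [s]. *)
Lemma boundary_unique s u v x : lower r s ->
  u \in boundary [set: V] r s -> v \in boundary [set: V] r s ->
  x \in desc u -> x \in desc v -> u = v.
Proof.
move=> sl; wlog uv : u v / u \in desc v => [H ub vb xu xv|].
  case: (desc_total xu xv) => [uv|vu]; first exact: H.
  by apply/esym; exact: H.
move=> /boundary_rootP [us pu] vb _ _; apply/eqP/contraT => nuv.
have /boundary_rootP [vs _] := vb.
have [ur|ur] := eqVneq u r.
  by move: nuv; rewrite ur in uv *; rewrite (desc_rootE uv) eqxx.
case: pu => [E|ps]; first by rewrite E eqxx in ur.
case: (desc_par uv) => [E|pv]; first by rewrite E eqxx in nuv.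
by move: vs; rewrite (lower_ancestor sl ps pv (desc_root v)).
Qed.

(** * Lower sets containing a given lower set *)

Section LowerExtensions.
Context {K : comPzRingType}.
Variables (B : V -> {set V} -> K) (F : V -> K).
Hypothesis B0 : forall v, B v finset.set0 = 1%R.
Variable s : {set V}.
Hypothesis sl : lower r s.

Let bs := boundary [set: V] r s.
(** [glue] and [cut] are the two directions of the bijection between families of lower sets of the
    branches and lower sets containing [s]. The predicate [fam] normalises families to be empty off
    [bs], which makes the family unique. *)
Let glue (f : {ffun V -> {set V}}) : {set V} := s :|: finset.cover [set f v | v in bs].
Let cut (w : {set V}) : {ffun V -> {set V}} :=
  [ffun v => if v \in bs then w :&: desc v else finset.set0].
Let fam (f : {ffun V -> {set V}}) := forall v,
  if v \in bs then (f v \subset desc v) && lower v (f v) else f v == finset.set0.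

Let glueP (f : {ffun V -> {set V}}) x :
  reflect (x \in s \/ exists2 v, v \in bs & x \in f v) (x \in glue f).
Proof.
rewrite /glue inE; apply: (iffP orP) => -[xs|H]; try by left.
  right; have /bigcupP [A /imsetP [v vb ->] xA] := H.
  by exists v.
by right; case: H => v vb xv; apply/bigcupP; exists (f v) => //; exact: imset_f.
Qed.

Let bs_disjoint v x : v \in bs -> x \in desc v -> x \notin s.
Proof.
exact: (boundary_disjoint rooted_at_setT (finset.subsetT s) sl).
Qed.

Let glue_desc f v : fam f -> v \in bs -> glue f :&: desc v = f v.
Proof.
move=> fF vb; have := fF v; rewrite vb => /andP[fv _].
apply/finset.setP => x; rewrite finset.in_setI; apply/andP/idP.
  case=> /glueP [xs|[u ub xu]] xv; first by have := bs_disjoint vb xv; rewrite xs.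
  have := fF u; rewrite ub => /andP[/fintype.subsetP/(_ x xu) xdu _].
  by rewrite -(boundary_unique sl ub vb xdu xv).
move=> xf; split; last exact: (fintype.subsetP fv).
by apply/glueP; right; exists v.
Qed.

Let glue_lower f : fam f -> lower r (glue f).
Proof.
move=> fF; apply/lowerP => x /glueP [xs|[v vb xv]] xr; apply/glueP.
  by left; move/lowerP: sl; apply.
have := fF v; rewrite vb => /andP[_ /lowerP fl].
have [E|nxv] := eqVneq x v; last by right; exists v => //; exact: fl.
have /boundary_rootP [_ []] := vb; rewrite -E; last by left.
by move=> E'; rewrite E' eqxx in xr.
Qed.

Let cut_glue f : fam f -> cut (glue f) = f.
Proof.
move=> fF; apply/ffunP => v; rewrite ffunE.
case vb : (v \in bs); first exact: glue_desc.
by have := fF v; rewrite vb => /eqP ->.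
Qed.

Let glue_cut w : lower r w -> s \subset w -> glue (cut w) = w.
Proof.
move=> wl sw; apply/finset.setP => x; apply/glueP/idP.
  case=> [|[v vb]]; first exact: (fintype.subsetP sw).
  by rewrite ffunE vb finset.in_setI => /andP[].
move=> xw; case xs : (x \in s); first by left.
have [v vb xv] := boundary_exists (negbT xs).
by right; exists v => //; rewrite ffunE vb finset.in_setI xw.
Qed.

Let cut_fam w : lower r w -> fam (cut w).
Proof.
move=> wl v; rewrite ffunE; case vb : (v \in bs) => //; rewrite finset.subsetIr /=.
apply/lowerP => x; rewrite !finset.in_setI => /andP[xw xv] nxv.
have xr : x != r.
  by apply: contra_neq nxv => E; rewrite E in xv *; rewrite (desc_rootE xv).
move/lowerP: wl => ->//=.
by case: (desc_par xv) => // E; rewrite E eqxx in nxv.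
Qed.

(** The root of the branch containing [u]; the default [r] is returned only for [u] in [s]. *)
Let top u := odflt r [pick v | (v \in bs) && (u \in desc v)].

Let topE v u : v \in bs -> u \in desc v -> top u = v.
Proof.
move=> vb uv; rewrite /top; case: pickP => [v' /andP[vb' uv']|/(_ v)].
  exact: boundary_unique sl vb' vb uv' uv.
by rewrite vb uv.
Qed.

(** The branches left by the glued set are sorted by the branch of [s] in which they lie; inside
    that branch they are what [f v] leaves. *)
Let glue_boundary f v u : fam f -> v \in bs ->
  (u \in boundary [set: V] r (glue f)) && (top u == v) =
  (u \in boundary (desc v) v (f v)).
Proof.
move=> fF vb; have fE := glue_desc fF vb.
have sg x : x \in s -> x \in glue f by move=> xs; apply/glueP; left.
apply/andP/idP => [[/boundary_rootP [ug pu] /eqP uv]|].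
  have us : u \notin s by apply: contra ug; exact: sg.
  have [v' vb' uv'] := boundary_exists us.
  rewrite (topE vb' uv') in uv; rewrite {}uv in vb' uv'.
  rewrite inE finset.in_setD uv' -fE finset.in_setI uv' !andbT ug /=.
  have [//|nuv /=] := eqVneq u v; rewrite finset.in_setI.
  have ur : u != r.
    by apply: contra_neq nuv => E; rewrite E in uv' *; rewrite (desc_rootE uv').
  case: pu => [E|->]; first by rewrite E eqxx in ur.
  by case: (desc_par uv') => // E; rewrite E eqxx in nuv.
rewrite inE finset.in_setD => /andP[/andP[uf uv] pu].
rewrite (topE vb uv) eqxx; split=> //; apply/boundary_rootP; split.
  by move: uf; rewrite -fE finset.in_setI uv andbT.
case/orP: pu => [/eqP ->|]; last by rewrite -fE finset.in_setI => /andP[]; right.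
by move: vb => /boundary_rootP [_ [->|/sg]]; [left|right].
Qed.

(* The supersets [w] of [s] correspond to the families of lower sets
   [w :&: desc v] in the branches left after removing [s]. *)
Lemma lower_extension_sum :
  (\sum_(w : {set V} | lower r w && (s \subset w))
     (\prod_(v in boundary w r s) B v (w :&: desc v)) *
     \prod_(u in boundary [set: V] r w) F u =
   \prod_(v in boundary [set: V] r s)
     \sum_(s' : {set V} | (s' \subset desc v) && lower v s')
       B v s' * \prod_(u in boundary (desc v) v s') F u)%R.
Proof.
(* The product of sums becomes a sum over families of lower sets, which [glue] then matches with the
   sets [w]. *)
rewrite (big_distr_big_dep finset.set0) /=.
rewrite (reindex_onto glue cut) /=; last by move=> w /andP[wl sw]; exact: glue_cut.
have famP f : reflect (fam f) (f \in pfamily finset.set0 [in bs]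
    (fun v => [pred s' : {set V} | (s' \subset desc v) && lower v s'])).
  apply: (iffP familyP) => H v; move: (H v); rewrite /= -?topredE /=.
    by case: ifP.
  by case: ifP.
have pE f : (lower r (glue f) && (s \subset glue f)) && (cut (glue f) == f) =
    (f \in pfamily finset.set0 [in bs]
    (fun v => [pred s' : {set V} | (s' \subset desc v) && lower v s'])).
  apply/idP/famP => [/andP[/andP[gl _] /eqP <-]|fF]; first exact: cut_fam.
  by rewrite glue_lower// finset.subsetUl cut_glue// eqxx.
apply: eq_big => [f|f]; first exact: pE.
rewrite pE => /famP fF; rewrite big_split /=; congr (_ * _)%R.
  (* Branches whose root is not in the glued set have an empty [f v], hence contribute the factor 1
     by [B0]; the others form the boundary of [s] in the glued set. *)
  rewrite [RHS](bigID (fun v => v \in glue f)) /=.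
  rewrite [X in (_ * X)%R]big1 ?mulr1; last first.
    move=> v /andP[vb vg].
    have := fF v; rewrite vb => /andP[/fintype.subsetP fv fl].
    suff -> : f v = finset.set0 by exact: B0.
    apply/eqP; apply: contraNT vg => /finset.set0Pn [x xf].
    apply/glueP; right; exists v => //.
    exact: lower_ancestor fl xf (fv x xf) (desc_refl v).
  apply: eq_big => [v|v]; last first.
    by rewrite !inE => /andP[/andP[vs vg] pv]; rewrite glue_desc// !inE vs.
  by rewrite !inE andbT -!andbA [X in _ && X]andbC.
(* The boundary of the glued set is grouped by branches of [s]. *)
rewrite (partition_big top [in bs]) /=; last first.
  move=> u /boundary_rootP [ug _].
  have us : u \notin s by apply: contra ug => us; apply/glueP; left.
  by have [v vb uv] := boundary_exists us; rewrite (topE vb uv).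
apply: eq_bigr => v vb; apply: eq_bigl => u; exact: glue_boundary.
Qed.

End LowerExtensions.

End Parents.

Arguments desc {V} par v.
Arguments lower {V} par v s.
Arguments rooted_at {V} r par A v.
Arguments boundary {V} par A v s.

(** * The Butcher product *)

Section RootedSubtrees.
Variable t : rooted_tree.
Implicit Types (A s : {set 'I_(tree_order t)}) (v : 'I_(tree_order t)).

(* [subtree s] is [subtree_at s (tree_root t)]; branches are also of this form. *)
Definition subtree_at A v : option tree :=
  match pselect (v \in A /\ connected_in (@tree_adj t) A) with
  | left (conj vA cA) => Some (\pi_tree (induced_tree vA cA))%qT
  | right _ => None
  end.

Lemma subtree_atE A v (vA : v \in A) (cA : connected_in (@tree_adj t) A) :
  subtree_at A v = Some (\pi_tree (induced_tree vA cA))%qT.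
Proof.
rewrite /subtree_at; case: pselect => [[vA' cA']|[]//].
by rewrite (bool_irrelevance vA' vA) (bool_irrelevance cA' cA).
Qed.

Lemma subtree_at0 A v : v \notin A -> subtree_at A v = None.
Proof. by move=> /negP vA; rewrite /subtree_at; case: pselect => [[]|]. Qed.

Lemma subtree_at_branch s v :
  Some (\pi_tree (branch s v))%qT =
  subtree_at (component (@tree_adj t) (finset.setC s) v) v.
Proof. by rewrite (subtree_atE (mem_component s v) (connected_branch s v)). Qed.

End RootedSubtrees.

(** * Invariance under embeddings of trees *)

Section Embeddings.
Variables (u t : rooted_tree) (f : 'I_(tree_order u) -> 'I_(tree_order t)).
Hypothesis f_inj : injective f.
Hypothesis f_adj : forall x y, tree_adj (f x) (f y) = tree_adj x y.
Implicit Types (A s : {set 'I_(tree_order u)}) (x y v : 'I_(tree_order u)).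

Lemma connect_embed A x y :
  connect (adj_in (@tree_adj t) (f @: A)) (f x) (f y) =
  connect (adj_in (@tree_adj u) A) x y.
Proof.
apply/idP/idP => /connectP [p].
  elim: p x => [|z p IH] x /=; first by move=> _ /f_inj ->; exact: connect0.
  case/andP => /and3P[xA /imsetP [w wA ->] a] pp yl.
  apply: connect_trans (IH w pp yl); apply: connect1.
  by rewrite /adj_in /= wA -f_adj a -(mem_imset A x f_inj) xA.
move=> pp ->; elim: p x pp => [|z p IH] x /=; first by rewrite connect0.
case/andP => /and3P[xA zA a] pp; apply: connect_trans (IH z pp); apply: connect1.
by rewrite /adj_in /= !mem_imset// f_adj; apply/and3P.
Qed.

Lemma connected_in_embed A :
  connected_in (@tree_adj t) (f @: A) = connected_in (@tree_adj u) A.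
Proof.
apply/connected_inP/connected_inP => H.
  by move=> x y xA yA; rewrite -connect_embed; apply: H; rewrite mem_imset.
move=> _ _ /imsetP [x xA ->] /imsetP [y yA ->].
by rewrite connect_embed; exact: H.
Qed.

Lemma component_embed A v : v \in A ->
  component (@tree_adj t) (f @: A) (f v) = f @: component (@tree_adj u) A v.
Proof.
move=> vA; apply/finset.setP => y; rewrite inE; apply/idP/imsetP => [c|[x + ->]].
  have : y \in f @: A.
    case/connectP: c => p pp ->; move: (imset_f f vA) pp.
    by elim: p (f v) => //= z p IH x xA /andP[/and3P[_ zA _]]; exact: IH.
  case/imsetP => x xA yE; exists x => //.
  by move: c; rewrite yE connect_embed inE.
by rewrite connect_embed inE.
Qed.

(** [f] restricts to an isomorphism from [A] to its image; [g] is this isomorphism read in the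
    ordinal numberings of the two vertex sets. *)
Lemma subtree_at_embed A v : subtree_at (f @: A) (f v) = subtree_at A v.
Proof.
case vA : (v \in A); last by rewrite !subtree_at0 ?mem_imset ?vA.
case cA : (connected_in (@tree_adj u) A); last first.
  have noC B w : ~~ connected_in (@tree_adj t) B -> subtree_at B w = None.
    by move=> /negP BC; rewrite /subtree_at; case: pselect => [[]|].
  rewrite noC ?connected_in_embed ?cA//.
  by rewrite /subtree_at; case: pselect => [[? cA']|//]; exfalso; rewrite cA in cA'.
have vA' : f v \in f @: A by rewrite mem_imset.
have cA' : connected_in (@tree_adj t) (f @: A) by rewrite connected_in_embed.
rewrite (subtree_atE vA cA) (subtree_atE vA' cA'); congr Some.
apply/esym/eqmodP/asboolP => /=.
have g_in (i : 'I_#|A|) : f (enum_val i) \in f @: A.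
  by rewrite mem_imset//; exact: enum_valP.
pose g (i : 'I_#|A|) : 'I_#|f @: A| := enum_rank_in vA' (f (enum_val i)).
have gE i : enum_val (g i) = f (enum_val i) by rewrite enum_rankK_in.
exists g; split.
- apply: inj_card_bij; last by rewrite !card_ord /= card_imset.
  by move=> i j /(congr1 enum_val); rewrite !gE => /f_inj /enum_val_inj.
- by rewrite /= /g enum_rankK_in.
- move=> i j; change (tree_adj (enum_val (g i)) (enum_val (g j)) =
    tree_adj (enum_val i) (enum_val j)).
  by rewrite !gE f_adj.
Qed.

End Embeddings.

(** * The product computed inside an ambient tree *)

Section ButcherProduct.
Context {K : comPzRingType}.
Implicit Types (a b c : option tree -> K).

(** Stated over any commutative ring, so that one formula serves both the real coordinates and the
    complexified ones. *)
Definition butcher_prod a b (tau : option tree) : K :=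
  match tau with
  | None => b None
  | Some theta =>
    let t := repr theta in
    \sum_(s in ordered_subtrees t)
      b (subtree s) * \prod_(u <- forest_complement s) a (Some u)
  end.

(** Moves all subtrees and branches of [u] onto vertex sets of [t], so that the terms of nested
    products can be compared within a single tree. *)
Lemma butcher_sum_embed (u t : rooted_tree)
    (f : 'I_(tree_order u) -> 'I_(tree_order t)) a b :
  injective f -> (forall x y, tree_adj (f x) (f y) = tree_adj x y) ->
  let A := (f @: [set: 'I_(tree_order u)])%SET in let v := f (tree_root u) in
  \sum_(s in ordered_subtrees u)
     b (subtree s) * \prod_(w <- forest_complement s) a (Some w) =
  \sum_(s : {set 'I_(tree_order t)} | (s \subset A) &&
     (connected_in (@tree_adj t) s && ((s != finset.set0) ==> (v \in s))))
     b (subtree_at s v) *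
     \prod_(w in [set w in A :\: s |
         (w == v) || [exists x, (x \in s) && tree_adj x w]])
       a (subtree_at (component (@tree_adj t) (A :\: s) w) w).
Proof.
move=> fi fa A v.
have fK (s : {set 'I_(tree_order u)}) : (f @^-1: (f @: s)) = s.
  by apply/finset.setP => x; rewrite inE mem_imset.
have compl (s : {set 'I_(tree_order u)}) : (A :\: f @: s) = f @: (finset.setC s).
  apply/finset.setP => y; rewrite inE; apply/andP/imsetP => [[ys /imsetP [x _ yE]]|[x xs ->]].
    by exists x => //; rewrite inE; apply: contra ys => xs; rewrite yE imset_f.
  by rewrite mem_imset//; move: xs; rewrite inE => ->; rewrite imset_f.
rewrite [RHS](reindex_onto (fun s : {set 'I_(tree_order u)} => f @: s)
   (fun s => f @^-1: s)) /=; last first.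
  move=> s /andP[sA _]; apply/finset.setP => y; apply/imsetP/idP => [[x]|ys].
    by rewrite inE => xs ->.
  have /imsetP [x _ yE] := fintype.subsetP sA y ys.
  by exists x => //; rewrite inE -yE.
apply: eq_big => [s|s _].
  rewrite fK eqxx andbT imsetS ?finset.subsetT//= connected_in_embed// mem_imset//.
  by rewrite inE -!cards_eq0 card_imset.
rewrite subtree_at_embed//; congr (_ * _).
rewrite /forest_complement big_map big_enum /=.
have -> : [set w in A :\: f @: s | (w == v) || [exists x, (x \in f @: s) && tree_adj x w]] =
  f @: branch_roots s.
  rewrite compl; apply/finset.setP => y; rewrite inE; apply/andP/imsetP.
    case=> /imsetP [x xs ->] H; exists x => //.
    rewrite inE; move: xs; rewrite inE => -> /=; case/orP: H => [/eqP/fi ->|].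
      by rewrite eqxx.
    case/existsP => z /andP[/imsetP [z' zs ->] za]; apply/orP; right.
    by apply/existsP; exists z'; rewrite zs -fa.
  case=> x; rewrite inE => /andP[xs H] ->; rewrite mem_imset// inE xs; split=> //.
  case/orP: H => [/eqP ->|/existsP [z /andP[zs za]]]; first by rewrite eqxx.
  by apply/orP; right; apply/existsP; exists (f z); rewrite mem_imset// zs fa.
rewrite big_imset /=; last by move=> x y _ _; exact: fi.
apply: eq_bigr => w; rewrite inE => /andP[ws _].
by rewrite compl component_embed ?inE// subtree_at_embed// subtree_at_branch.
Qed.

(** The representative chosen by [repr] is isomorphic to the tree induced on [A], hence embeds in
    [t] with image [A]. *)
Lemma butcher_prod_subtree_at (t : rooted_tree) (A : {set 'I_(tree_order t)}) v a b :
  v \in A -> connected_in (@tree_adj t) A ->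
  butcher_prod a b (subtree_at A v) =
  \sum_(s : {set 'I_(tree_order t)} | (s \subset A) &&
     (connected_in (@tree_adj t) s && ((s != finset.set0) ==> (v \in s))))
     b (subtree_at s v) *
     \prod_(w in [set w in A :\: s |
         (w == v) || [exists x, (x \in s) && tree_adj x w]])
       a (subtree_at (component (@tree_adj t) (A :\: s) w) w).
Proof.
move=> vA cA; rewrite (subtree_atE vA cA) /=.
set th := (\pi_tree _)%qT.
have /eqmodP/asboolP /= [g [gb gr ga]] : (repr th = induced_tree vA cA %[mod tree])%qT.
  by rewrite reprK.
pose f x : 'I_(tree_order t) := enum_val (g x).
have fi : injective f by move=> x y /enum_val_inj; exact: bij_inj.
have fa x y : tree_adj (f x) (f y) = tree_adj x y by rewrite -ga.
have := butcher_sum_embed a b fi fa => /= ->.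
have -> : f @: [set: 'I_(tree_order (repr th))] = A.
  apply/finset.setP => x; apply/imsetP/idP => [[y _ ->]|xA]; first exact: enum_valP.
  have [h _ hK] := gb; exists (h (enum_rank_in vA x)) => //.
  by rewrite /f hK enum_rankK_in.
by rewrite /f gr /= enum_rankK_in.
Qed.

Lemma subtree_at_setT (t : rooted_tree) :
  subtree_at [set: 'I_(tree_order t)] (tree_root t) = Some (\pi_tree t)%qT.
Proof.
have rT := finset.in_setT (tree_root t).
have TC : connected_in (@tree_adj t) [set: 'I_(tree_order t)].
  apply/connected_inP => x y _ _; have [_ _ H _] := tree_is_tree t.
  have := H x y; congr (connect _ x y).
  by apply/funext => z; apply/funext => w; rewrite /adj_in /= !finset.in_setT.
rewrite (subtree_atE rT TC); congr Some; apply/eqmodP/asboolP => /=.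
exists enum_val; split => //.
- apply: inj_card_bij; first exact: enum_val_inj.
  by rewrite !card_ord /= cardsT card_ord.
- by rewrite /= enum_rankK_in.
Qed.

End ButcherProduct.

(** * Associativity, unit and inverse *)

Section ButcherAlgebra.
Context {K : comPzRingType}.
Implicit Types (a b c : option tree -> K) (t : rooted_tree).

Definition butcher_unit (tau : option tree) : K := if tau is Some _ then 0 else 1.

Section Parents.
Variables (t : rooted_tree).
Variables (par : 'I_(tree_order t) -> 'I_(tree_order t)) (d : 'I_(tree_order t) -> nat).
Local Notation r := (tree_root t).
Hypothesis par_root : par r = r.
Hypothesis par_lt : forall x, x != r -> (d (par x) < d x)%N.
Hypothesis adjE : forall x y,
  @tree_adj t x y = [|| (x != r) && (y == par x) | (y != r) && (x == par y)].

Lemma butcher_prod_rooted_at (A : {set 'I_(tree_order t)}) v a b :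
  rooted_at r par A v ->
  butcher_prod a b (subtree_at A v) =
  \sum_(s : {set 'I_(tree_order t)} | (s \subset A) && lower par v s)
     b (subtree_at s v) *
     \prod_(w in boundary par A v s) a (subtree_at (A :&: desc par w) w).
Proof.
move=> Av; have [vA _] := rooted_atP _ _ Av.
rewrite (butcher_prod_subtree_at _ _ vA (rooted_at_connected par_lt adjE Av)).
apply: eq_big => [s|s /andP[sA]].
  by case sA : (s \subset A) => //; rewrite (lower_ordered par_root par_lt adjE Av sA).
rewrite (lower_ordered par_root par_lt adjE Av sA) => sl; congr (_ * _).
rewrite -(boundaryE par_root par_lt adjE Av sA sl).
by apply: eq_bigr => w wb; rewrite (boundary_component par_root par_lt adjE Av sA sl wb).
Qed.

Lemma subtree_at_set0 (v : 'I_(tree_order t)) : subtree_at finset.set0 v = None.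
Proof. by apply: subtree_at0; rewrite finset.in_set0. Qed.

(** A non-empty lower set contains [r] and is rooted there; for the empty one both sides reduce to
    [c None]. *)
Lemma butcher_prod_lower w b c : c None = b None -> b None = 1 ->
  lower par r w ->
  butcher_prod b c (subtree_at w r) =
  \sum_(s : {set 'I_(tree_order t)} | (s \subset w) && lower par r s)
     c (subtree_at s r) *
     \prod_(v in boundary par w r s) b (subtree_at (w :&: desc par v) v).
Proof.
move=> c0 b0 wl; have [->|w0] := eqVneq w finset.set0.
  rewrite subtree_at_set0 /= (big_pred1 finset.set0) => [|s].
    rewrite subtree_at_set0 big_pred0 ?mulr1// => v.
    by rewrite inE finset.set0D finset.in_set0.
  rewrite /= finset.subset0; have [->|//] := eqVneq s finset.set0.
  by apply/lowerP => x; rewrite finset.in_set0.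
apply: butcher_prod_rooted_at; apply/rooted_atP.
have H x : x \in w -> x != r -> x != r /\ par x \in w.
  by move=> xw xr; split => //; move/lowerP: wl; exact.
split => //; have /finset.set0Pn [x xw] := w0.
exact: (lower_ancestor par_root par_lt wl xw (desc_root par_lt x) (desc_refl r)).
Qed.

(** Both sides equal a sum over pairs of lower sets, [s] inside [w]: [c] is applied to [s], [b] to
    the branches of [w] beyond [s], and [a] to the branches beyond [w]. *)
Lemma butcher_prodA_root a b c : b None = 1 -> c None = 1 ->
  butcher_prod (butcher_prod a b) c (subtree_at [set: 'I_(tree_order t)] r) =
  butcher_prod a (butcher_prod b c) (subtree_at [set: 'I_(tree_order t)] r).
Proof.
move=> b0 c0; have rT := @rooted_at_setT _ r par.
rewrite !butcher_prod_rooted_at//.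
transitivity (\sum_(s : {set 'I_(tree_order t)} | lower par r s)
  \sum_(w : {set 'I_(tree_order t)} | lower par r w && (s \subset w))
   c (subtree_at s r) *
   ((\prod_(v in boundary par w r s) b (subtree_at (w :&: desc par v) v)) *
     \prod_(u in boundary par [set: _] r w) a (subtree_at (desc par u) u))).
  apply: eq_big => [s|s /andP[_ sl]]; first by rewrite finset.subsetT.
  rewrite -big_distrr /=; congr (_ * _).
  (* Here [b] weighs the part of [w] in each branch of [s], and [a] weighs the branches left by [w];
     the weight of an empty part is [b None = 1]. *)
  rewrite (lower_extension_sum par_root par_lt
    (B := fun v s => b (subtree_at s v))
    (fun u => a (subtree_at (desc par u) u))) => [|v|//]; last first.
    by rewrite subtree_at_set0.
  apply: eq_bigr => v vb; rewrite finset.setTI.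
  rewrite butcher_prod_rooted_at; last first.
    by rewrite -[desc par v]finset.setTI;
      apply: (rooted_at_inter_desc par_root par_lt rT); rewrite finset.in_setT.
  apply: eq_bigr => s' _; congr (_ * _).
  apply: eq_bigr => u; rewrite inE finset.in_setD => /andP[/andP[_ uv] _].
  congr (a (subtree_at _ _)); apply/finset.setIidPr/fintype.subsetP => y.
  exact: desc_trans.
(* With [w] outermost, the inner sum over [s] is the product of [b] and [c] on the tree induced on
   [w]. *)
rewrite (exchange_big_dep (lower par r)) /=; last by move=> s w _ /andP[].
apply: eq_big => [w|w wl]; first by rewrite finset.subsetT.
rewrite butcher_prod_lower ?b0 ?c0// big_distrl /=.
apply: eq_big => [s|s _]; first by rewrite andbC wl.
by rewrite mulrA; congr (_ * _); apply: eq_bigr => u _; rewrite finset.setTI.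
Qed.

(** Only the full subtree leaves no branch; every other one leaves a branch, on which the unit
    vanishes. *)
Lemma butcher_unit_prod_root b :
  butcher_prod butcher_unit b (subtree_at [set: 'I_(tree_order t)] r) =
  b (subtree_at [set: 'I_(tree_order t)] r).
Proof.
have rT := @rooted_at_setT _ r par.
rewrite butcher_prod_rooted_at//.
rewrite (bigD1 [set: _]) /=; last first.
  rewrite finset.subsetT; apply/lowerP => x _ _; exact: finset.in_setT.
rewrite big_pred0 => [|w]; last by rewrite inE finset.setDv finset.in_set0.
rewrite mulr1 big1 ?addr0// => s /andP[/andP[_ sl] sT].
have [x xs] : exists x, x \notin s.
  by apply/existsP; apply: contraNT sT; rewrite negb_exists => /forallP H;
     apply/eqP/finset.setP => x; rewrite finset.in_setT -[LHS]negbK (negbTE (H x)).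
have [v vb _] := boundary_exists par_lt xs.
rewrite (bigD1 v) //= finset.setTI.
have vR : rooted_at r par (desc par v) v.
  by rewrite -[desc par v]finset.setTI;
      apply: (rooted_at_inter_desc par_root par_lt rT); rewrite finset.in_setT.
by rewrite (subtree_atE (desc_refl v) (rooted_at_connected par_lt adjE vR)) mul0r mulr0.
Qed.

End Parents.

Lemma reprE (theta : tree) :
  Some theta = subtree_at [set: 'I_(tree_order (repr theta))] (tree_root (repr theta)).
Proof. by rewrite subtree_at_setT reprK. Qed.

Lemma butcher_prodA a b c : b None = 1 -> c None = 1 ->
  butcher_prod (butcher_prod a b) c =1 butcher_prod a (butcher_prod b c).
Proof.
move=> b0 c0 [theta|//]; rewrite reprE.
have [par [d [pr pl aE]]] :=
  tree_parent_exists (tree_is_tree (repr theta)) (tree_root (repr theta)).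
exact: butcher_prodA_root pr pl aE _ _ _ b0 c0.
Qed.

Lemma butcher_unit_prod b : b None = 1 -> butcher_prod butcher_unit b =1 b.
Proof.
move=> b0 [theta|//]; rewrite reprE.
have [par [d [pr pl aE]]] :=
  tree_parent_exists (tree_is_tree (repr theta)) (tree_root (repr theta)).
exact: butcher_unit_prod_root pr pl aE _.
Qed.

Lemma forest_complement0 t :
  forest_complement (finset.set0 : {set 'I_(tree_order t)}) = [:: (\pi_tree t)%qT].
Proof.
rewrite /forest_complement.
have -> : branch_roots (finset.set0 : {set 'I_(tree_order t)}) = [set tree_root t].
  apply/finset.setP => v; rewrite !inE /=; apply/orP/idP => [[//|/existsP [u]]|->].
    by rewrite finset.in_set0.
  by left.
rewrite enum_set1 /=; congr cons; apply: Some_inj.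
rewrite subtree_at_branch -subtree_at_setT; congr subtree_at.
have [_ _ H _] := tree_is_tree t.
apply/finset.setP => v; rewrite inE finset.in_setT; have := H (tree_root t) v.
congr (connect _ _ _).
by apply/funext => z; apply/funext => w; rewrite /adj_in /= finset.setC0 !finset.in_setT.
Qed.

Lemma subtree_set0 t : subtree (finset.set0 : {set 'I_(tree_order t)}) = None.
Proof. exact: subtree_at_set0. Qed.

Lemma subtree_neq0 t (s : {set 'I_(tree_order t)}) :
  s \in ordered_subtrees t -> s != finset.set0 -> subtree s != None.
Proof.
rewrite inE => /andP[sC /implyP H] /H rs.
by rewrite -[subtree s]/(subtree_at s _) (subtree_atE rs sC).
Qed.

Lemma set0_ordered t : finset.set0 \in ordered_subtrees t.
Proof.
rewrite inE eqxx andbT; apply/connected_inP => x y; rewrite finset.in_set0 //.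
Qed.

(** Only the empty subtree survives, and its complement is the whole tree. *)
Lemma butcher_prod_unit a : a None = 1 -> butcher_prod a butcher_unit =1 a.
Proof.
move=> a0 [theta|//]; rewrite /butcher_prod.
rewrite (bigD1 finset.set0) ?set0_ordered//= subtree_set0 mul1r.
rewrite forest_complement0 big_seq1 reprK big1 ?addr0// => s /andP[so s0].
by have := subtree_neq0 so s0; case: subtree => //= *; rewrite mul0r.
Qed.

(** * Inversion by recursion on the number of vertices *)

Definition order (tau : option tree) : nat :=
  if tau is Some theta then tree_order (repr theta) else 0.

Lemma order_pi t : order (Some (\pi_tree t)%qT) = tree_order t.
Proof.
rewrite /order; have /eqmodP/asboolP /= [f [fb _ _]] :
  (repr (\pi_tree t)%qT = t %[mod tree])%qT by rewrite reprK.
by have := bij_eq_card fb; rewrite !card_ord.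
Qed.

(** Every branch misses a vertex of the non-empty [s]; this strict decrease justifies the recursion
    for the inverse. *)
Lemma order_forest t (s : {set 'I_(tree_order t)}) theta :
  s != finset.set0 -> theta \in forest_complement s ->
  (order (Some theta) < tree_order t)%N.
Proof.
move=> /finset.set0Pn [x xs] /mapP [v]; rewrite mem_enum inE => /andP[vs _] ->.
rewrite order_pi /= -[X in (_ < X)%N]card_ord -cardsT; apply: proper_card.
apply/properP; split; first exact: finset.subsetT.
exists x; rewrite ?finset.in_setT// inE; apply/negP => /connectP [p pp].
have vs' : v \in finset.setC s by rewrite inE.
elim: p v vs' {vs} pp => [|z p IH] v vs /=.
  by move=> _ xv; rewrite inE -xv xs in vs.
by case/andP => /and3P[_ zs _]; exact: IH.
Qed.

(* [n] bounds the number of vertices; the value at [Some _, 0] is junk. *)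
Fixpoint butcher_inv_rec (n : nat) a (tau : option tree) : K :=
  match tau, n with
  | None, _ => 1
  | Some _, 0 => 0
  | Some theta, n'.+1 =>
    - \sum_(s in ordered_subtrees (repr theta) | s != finset.set0)
        a (subtree s) *
        \prod_(u <- forest_complement s) butcher_inv_rec n' a (Some u)
  end.

Definition butcher_inv a (tau : option tree) : K := butcher_inv_rec (order tau) a tau.

Lemma order_gt0 theta : (0 < order (Some theta))%N.
Proof. exact: leq_ltn_trans (leq0n _) (ltn_ord (tree_root (repr theta))). Qed.

Lemma butcher_inv_recE a n tau : (order tau <= n)%N ->
  butcher_inv_rec n a tau = butcher_inv a tau.
Proof.
(* Generalised to two arbitrary recursion depths [n] and [m], both at least the order, so that the
   induction can lower both. *)
rewrite /butcher_inv; move: {2 4}(order tau) (leqnn (order tau)) => m.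
elim: n m tau => [|n IH] m [theta|]; first by move=> _; rewrite leqNgt order_gt0.
- by case: m.
- case: m => [|m]; first by rewrite leqNgt order_gt0.
  move=> tm tn; rewrite [RHS]/= [LHS]/=; congr (- _).
  apply: eq_bigr => s /andP[_ s0]; congr (_ * _).
  rewrite !big_seq; apply: eq_bigr => u uf; have uo := order_forest s0 uf.
  apply: IH; rewrite -ltnS; [exact: leq_trans uo tm|exact: leq_trans uo tn].
- by case: m.
Qed.

(** The empty subtree contributes the inverse at [theta] with coefficient [a None = 1], and the
    recursion defines that value as the negative of the remaining sum. *)
Lemma butcher_inv_prod a : a None = 1 ->
  butcher_prod (butcher_inv a) a =1 butcher_unit.
Proof.
move=> a0 [theta|//]; rewrite /butcher_prod.
rewrite (bigD1 finset.set0) ?set0_ordered//= subtree_set0 a0 mul1r.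
rewrite forest_complement0 big_seq1 reprK {1}/butcher_inv.
have [n nE] : exists n, order (Some theta) = n.+1.
  by case: (order _) (order_gt0 theta) => // n _; exists n.
rewrite nE /= addrC; apply/eqP; rewrite subr_eq0; apply/eqP.
apply: eq_bigr => s /andP[_ s0]; congr (_ * _).
rewrite !big_seq; apply: eq_bigr => u uf; have uo := order_forest s0 uf.
by apply/esym/butcher_inv_recE; rewrite -ltnS -nE.
Qed.

End ButcherAlgebra.

Section ButcherMorphism.
Context {K L : comPzRingType} (phi : {rmorphism K -> L}).

(** For the embedding of [R] into [R[i]], this says that the complex formula extends the real
    one. *)
Lemma rmorph_butcher_prod (a b : option tree -> K) tau :
  phi (butcher_prod a b tau) = butcher_prod (phi \o a) (phi \o b) tau.
Proof.
case: tau => [theta|//]; rewrite /= rmorph_sum; apply: eq_bigr => s _.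
by rewrite rmorphM rmorph_prod.
Qed.

Lemma rmorph_butcher_inv (a : option tree -> K) tau :
  phi (butcher_inv a tau) = butcher_inv (phi \o a) tau.
Proof.
rewrite /butcher_inv; move: (order tau) => n.
elim: n tau => [|n IH] [theta|]; rewrite [in RHS]/= [in LHS]/= ?rmorph0 ?rmorph1//.
rewrite rmorphN rmorph_sum; congr (- _); apply: eq_bigr => s _.
by rewrite rmorphM rmorph_prod; congr (_ * _); apply: eq_bigr => u _; exact: IH.
Qed.

End ButcherMorphism.

Local Open Scope classical_set_scope.

(** * Polynomial maps are Bastiani smooth *)

Section PolynomialFamilies.
Context {K : numFieldType} {T : topologicalType} {E : tvsType K}.

(* The parameter space [T] will be the space of tuples of directions, so that
   joint continuity of the iterated derivatives is continuity on [T * E]. *)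
Inductive polyfam : (T -> E -> K^o) -> Prop :=
| polyfam_cst (c : T -> K^o) : continuous c -> polyfam (fun t _ => c t)
| polyfam_lin (l : E -> K^o) : continuous l ->
    (forall h x v, l (x + h *: v) = l x + h * l v) -> polyfam (fun _ => l)
| polyfam_add f g : polyfam f -> polyfam g ->
    polyfam (fun t x => f t x + g t x)
| polyfam_mul f g : polyfam f -> polyfam g ->
    polyfam (fun t x => f t x * g t x).

Lemma polyfam_continuous f : polyfam f ->
  continuous (fun p : T * E => f p.1 p.2).
Proof.
elim=> {f} [c cc|l lc _|f g _ fc _ gc|f g _ fc _ gc] p.
- by apply: continuous_comp; [exact: cvg_fst|exact: cc].
- by apply: continuous_comp; [exact: cvg_snd|exact: lc].
- exact: cvgD (fc p) (gc p).
- exact: cvgM (fc p) (gc p).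
Qed.

Lemma line_cvg (x v : E) : (fun h : K^o => x + h *: v) @ (0 : K^o)^' --> x.
Proof.
have H : (fun h : K^o => x + h *: v) @ (0 : K^o) --> x + (0 : K^o) *: v.
  have sc := @scale_continuous K E (0, v).
  have c1 : (fun h : K^o => h *: v) @ (0 : K^o) --> (0 : K^o) *: v.
    apply: (@cvg_comp _ _ _ (fun h : K^o => (h, v)) _ _ _ _ _ sc).
    apply: (@cvg_pair _ _ _ _ (nbhs (0 : K^o)) (nbhs (v : E))) => /=.
    + exact: (nbhs_filter (0 : K^o)).
    + by move=> A.
    + exact: (@cvg_cst _ _ _ _ (nbhs_filter (0 : K^o))).
  have ac := @add_continuous E (x, (0 : K^o) *: v).
  apply: (@cvg_comp _ _ _ (fun h : K^o => (x, h *: v)) _ _ _ _ _ ac).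
  apply: (@cvg_pair _ _ _ _ (nbhs (x : E)) (nbhs ((0 : K^o) *: v))) => //=.
  + exact: (nbhs_filter (0 : K^o)).
  + exact: (@cvg_cst _ _ _ _ (nbhs_filter (0 : K^o))).
rewrite scale0r addr0 in H.
apply: cvg_trans H; apply: cvg_app; exact: nbhs_dnbhs.
Qed.

Arguments line_cvg : clear implicits.
Lemma is_dir_derivative_lin (l : E -> K^o) v x :
  (forall h x v, l (x + h *: v) = l x + h * l v) ->
  is_dir_derivative l v x (l v).
Proof.
move=> ll; apply: cvg_near_cst.
near=> h; rewrite /difference_quotient ll addrAC subrr add0r.
rewrite /GRing.scale /= mulKf //; near: h; exact: nbhs_dnbhs_neq.
Unshelve. all: by end_near. Qed.

Lemma is_dir_derivative_add (f g : E -> K^o) v x a b :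
  is_dir_derivative f v x a -> is_dir_derivative g v x b ->
  is_dir_derivative (fun y => f y + g y) v x (a + b).
Proof.
move=> fa gb; apply: cvg_trans (cvgD fa gb); apply: near_eq_cvg; near=> h.
transitivity (difference_quotient f x v h + difference_quotient g x v h) => //.
have quotientD (k p q r s : K) : k * (p - r) + k * (q - s) = k * (p + q - (r + s)) by ring.
exact: (quotientD h^-1 (f (x + h *: v)) (g (x + h *: v)) (f x) (g x)).
Unshelve. all: by end_near. Qed.

(** The difference quotient of the product is that of [f] times the shifted value [g (x + h *: v)],
    plus [f x] times that of [g]; continuity of [g] gives the limit of the shifted value. *)
Lemma is_dir_derivative_mul (f g : E -> K^o) v x a b :
  {for x, continuous g} ->
  is_dir_derivative f v x a -> is_dir_derivative g v x b ->
  is_dir_derivative (fun y => f y * g y) v x (a * g x + f x * b).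
Proof.
move=> gc fa gb.
have gl : (fun h : K^o => g (x + h *: v)) @ (0 : K^o)^' --> g x.
  by apply: (@cvg_comp _ _ _ (fun h : K^o => x + h *: v) g _ _ _ _ gc); exact: line_cvg.
have fc : (fun h : K^o => f x) @ (0 : K^o)^' --> f x by exact: cvg_cst.
have ml : (fun h : K^o => difference_quotient f x v h * g (x + h *: v) : K^o)
    @ (0 : K^o)^' --> (a * g x : K^o) by exact: cvgM fa gl.
have mr : (fun h : K^o => f x * difference_quotient g x v h : K^o)
    @ (0 : K^o)^' --> (f x * b : K^o) by exact: cvgM fc gb.
apply: cvg_trans (cvgD ml mr); apply: near_eq_cvg; near=> h.
transitivity (difference_quotient f x v h * g (x + h *: v) +
  f x * difference_quotient g x v h) => //.
have quotientM (k p q r s : K) :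
  k * (p - r) * q + r * (k * (q - s)) = k * (p * q - r * s) by ring.
exact: (quotientM h^-1 (f (x + h *: v)) (g (x + h *: v)) (f x) (g x)).
Unshelve. all: by end_near. Qed.

Lemma polyfam_continuousr f t : polyfam f -> continuous (f t).
Proof.
move=> /polyfam_continuous fc x.
have := fc (t, x); apply: (continuous_comp (f := fun y => (t, y))).
by apply: cvg_pair => /=; [exact: cvg_cst|exact: cvg_id].
Qed.

(** The derivative of a linear form along [v t] is [l (v t)], a coefficient depending continuously
    on the parameter; sums and products follow by the Leibniz rules. *)
Lemma polyfam_derivative f (v : T -> E) : polyfam f -> continuous v ->
  exists2 g, polyfam g & forall t x, is_dir_derivative (f t) (v t) x (g t x).
Proof.
move=> + vc; elim=> {f} [c cc|l lc ll|f g pf [f' pf' df] pg [g' pg' dg]|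
  f g pf [f' pf' df] pg [g' pg' dg]].
- exists (fun _ _ => 0); first by apply: (@polyfam_cst (fun=> 0)); exact: cst_continuous.
  move=> t x; apply: cvg_near_cst; near=> h.
  by rewrite /difference_quotient subrr scaler0.
- exists (fun t _ => l (v t)).
    apply: (@polyfam_cst (fun t => l (v t))) => t.
    by apply: continuous_comp; [exact: vc|exact: lc].
  by move=> t x; exact: is_dir_derivative_lin.
- exists (fun t x => f' t x + g' t x); first exact: polyfam_add.
  by move=> t x; exact: is_dir_derivative_add.
- exists (fun t x => f' t x * g t x + f t x * g' t x).
    by apply: polyfam_add; exact: polyfam_mul.
  move=> t x; apply: is_dir_derivative_mul => //; exact: polyfam_continuousr.
Unshelve. all: by end_near. Qed.

Lemma polyfam_sum (I : Type) (r : seq I) (P : pred I) (f : I -> T -> E -> K^o) :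
  (forall i, polyfam (f i)) -> polyfam (fun t x => \sum_(i <- r | P i) f i t x).
Proof.
move=> pf; elim: r => [|i r IH].
  under eq_fun do under eq_fun do rewrite big_nil.
  by apply: (@polyfam_cst (fun=> 0)); exact: cst_continuous.
under eq_fun do under eq_fun do rewrite big_cons.
by case: (P i) => //; apply: polyfam_add.
Qed.

Lemma polyfam_prod (I : Type) (r : seq I) (P : pred I) (f : I -> T -> E -> K^o) :
  (forall i, polyfam (f i)) -> polyfam (fun t x => \prod_(i <- r | P i) f i t x).
Proof.
move=> pf; elim: r => [|i r IH].
  under eq_fun do under eq_fun do rewrite big_nil.
  by apply: (@polyfam_cst (fun=> 1)); exact: cst_continuous.
under eq_fun do under eq_fun do rewrite big_cons.
by case: (P i) => //; apply: polyfam_mul.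
Qed.

End PolynomialFamilies.

(** * Smoothness of polynomial maps into product spaces *)

Section SmoothPolynomials.
Context {K : numFieldType} {E F : tvsType K} {I : Type}.
Variables (coord : I -> F -> K^o) (mk : (I -> K^o) -> F).

(** Captures a power of the base field through its coordinates, so that a space of tree maps over
    the reals and its complexification over [R[i]] are treated at once. *)
Record product_coordinates : Prop := ProductCoordinates {
  coord_mk : forall i g, coord i (mk g) = g i;
  coord_inj : forall x y, (forall i, coord i x = coord i y) -> x = y;
  coord_linear : forall i h x v, coord i (x + h *: v) = coord i x + h * coord i v;
  coord_continuous : forall i, continuous (coord i);
  coord_cvg : forall (S : Type) (G : set_system S) (g : S -> F) (f : F),
    Filter G -> (forall i, (fun s => coord i (g s)) @ G --> coord i f) ->
    g @ G --> f }.

Hypothesis cF : product_coordinates.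

Lemma coordB i x y : coord i (x - y) = coord i x - coord i y.
Proof. by rewrite -scaleN1r coord_linear // mulN1r. Qed.

Lemma coordZ i h x : coord i (h *: x) = h * coord i x.
Proof.
have c0 : coord i 0 = 0 by have := coordB i 0 0; rewrite !subrr.
by rewrite -[h *: x]add0r coord_linear // c0 add0r.
Qed.

Lemma is_dir_derivative_coord (f : E -> F) v x l :
  (forall i, is_dir_derivative (fun y => coord i (f y)) v x (coord i l)) ->
  is_dir_derivative f v x l.
Proof.
move=> fl; apply: (coord_cvg cF) => i.
apply: cvg_trans (fl i); apply: near_eq_cvg; near=> h.
by rewrite /difference_quotient coordZ coordB.
Unshelve. all: by end_near. Qed.

(** [dir_derivative] chooses some limit; the limit is unique because the coordinates are continuous
    into a Hausdorff field and separate points. *)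
Lemma dir_derivative_coordE (f : E -> F) v x l :
  is_dir_derivative f v x l -> dir_derivative f v x = l.
Proof.
move=> fl; apply: xget_unique => // l' fl'; apply: coord_inj => // i.
have lim m : is_dir_derivative f v x m ->
    (fun h => coord i (difference_quotient f x v h)) @ (0 : K^o)^' --> coord i m.
  by move=> H; apply: cvg_comp H _; exact: coord_continuous.
by apply: cvg_unique (lim _ fl') (lim _ fl); exact: norm_hausdorff.
Qed.

Lemma polyfam_iter (T : topologicalType) (f : T -> E -> F) (vs : seq (T -> E)) :
  (forall i, polyfam (fun t x => coord i (f t x))) ->
  (forall v, List.In v vs -> continuous v) ->
  exists2 g, (forall i, polyfam (fun t x => coord i (g t x))) &
   forall t, iter_dir_derivative (f t) [seq v t | v <- vs] = g t.
Proof.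
elim: vs f => [|v vs IH] f pf cvs; first by exists f.
have H i := polyfam_derivative (pf i) (cvs v (or_introl erefl)).
(* The derivatives of the coordinates, chosen one by one, are assembled into a single map to which
   the induction applies. *)
pose f' t x := mk (fun i => sval (cid2 (H i)) t x).
have f'E t x i : coord i (f' t x) = sval (cid2 (H i)) t x by rewrite coord_mk.
have [|w wvs|g pg gE] := IH f'.
- move=> i; under eq_fun do under eq_fun do rewrite f'E.
  by case: cid2.
- by apply: cvs; right.
exists g => // t; rewrite -gE /=; congr (foldl _ _ _); apply/funext => x.
apply: dir_derivative_coordE; apply: is_dir_derivative_coord => i.
by rewrite f'E; case: cid2.
Qed.

(** Quantified over [T], because existence of the derivatives and their joint continuity are
    obtained with different parameter spaces. *)
Definition polynomial_map (f : E -> F) : Prop :=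
  forall (T : topologicalType) i, polyfam (fun (_ : T) x => coord i (f x)).

Lemma bastiani_smooth_polynomial (f : E -> F) :
  polynomial_map f -> bastiani_smooth setT f.
Proof.
move=> pf r; split; first exact: openT.
- move=> ys v x _ _.
  have [|_ /List.in_map_iff [y [<- _]]|g pg gE] :=
    @polyfam_iter E (fun=> f) [seq (fun=> y) | y <- ys].
  + exact: pf.
  + exact: cst_continuous.
  (* The directions are constant in the parameter, so [g] may be evaluated at any parameter, here
     0. *)
  have -> : iter_dir_derivative f ys = g 0.
    by rewrite -gE -map_comp map_id.
  have H i := polyfam_derivative (pg i) (@cst_continuous E E v).
  exists (mk (fun i => sval (cid2 (H i)) 0 x)).
  apply: is_dir_derivative_coord => i; rewrite coord_mk //.
  by case: cid2.
- move=> k _ x y _.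
  (* Now the parameter is the tuple of directions itself and the directions are its projections;
     continuity of [g] in both arguments is joint continuity of the [k]-th derivative. *)
  pose pr (i : 'I_k) := fun u : {ptws 'I_k -> E} => u i.
  have [|_ /List.in_map_iff [i [<- _]]|g pg gE] :=
    @polyfam_iter {ptws 'I_k -> E} (fun=> f) [seq pr i | i <- enum 'I_k].
  + exact: pf.
  + exact: (@proj_continuous {classic 'I_k} (fun=> E) i).
  have -> : (fun p : E * {ptws 'I_k -> E} =>
           iter_dir_derivative f [seq p.2 i | i <- enum 'I_k] p.1) =
     fun p => g p.2 p.1.
    apply/funext => p; rewrite -gE; congr (iter_dir_derivative f _ _).
    exact: (map_comp (fun u => u p.2) pr).
  apply: (coord_cvg cF) => i.
  have gc := polyfam_continuous (pg i).
  have sc : {for (x, y), continuous (fun p : E * {ptws 'I_k -> E} => (p.2, p.1))}.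
    by apply: (@cvg_pair _ _ _ _ (nbhs (y : {ptws 'I_k -> E})) (nbhs (x : E))) => /=;
      [exact: cvg_snd|exact: cvg_fst].
  exact: (continuous_comp sc (gc (y, x))).
Qed.

End SmoothPolynomials.

(** * Complexified coordinates *)

Section ComplexNumbers.
Context {R : realType}.

(** The order of [R[i]] compares only numbers with equal imaginary parts, so a positive radius is
    real. *)
Lemma complex_pos_Re (e : R[i]) : 0 < e -> exists2 d : R, 0 < d & e = d%:C%C.
Proof.
case: e => a b; rewrite ltcE /= => /andP[/eqP b0 a0].
by exists a => //; rewrite b0.
Qed.

Lemma real_complex_continuous : continuous (fun r : R^o => r%:C%C : R[i]^o).
Proof.
move=> r; apply/(@cvgrPdist_lt _ R[i]^o _ (nbhs (r : R^o))) => e.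
case/complex_pos_Re => d d0 ->.
have /cvgrPdist_lt/(_ d d0) : (fun x : R^o => x) @ r --> r by [].
apply: filterS => x; rewrite -rmorphB /= normc_def /= expr0n /= addr0 sqrtr_sqr.
by rewrite ltcR.
Qed.

Lemma complex_Re_continuous : continuous (@complex.Re R : R[i]^o -> R^o).
Proof.
move=> z; apply/(@cvgrPdist_lt _ R^o _ (nbhs (z : R[i]^o)) _ _ _) => e e0.
have /(@cvgrPdist_lt _ R[i]^o)/(_ (e%:C)%C) : (fun x : R[i]^o => x) @ z --> z by [].
rewrite ltcR => /(_ e0); apply: filterS => w h; rewrite -ltcR.
by apply: le_lt_trans h; rewrite -raddfB; exact: normc_ge_Re.
Qed.

Lemma complex_Im_continuous : continuous (@complex.Im R : R[i]^o -> R^o).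
Proof.
move=> z.
have -> : (@complex.Im R : R[i]^o -> R^o) =
    (fun w : R[i]^o => complex.Re (w * (- 'i%C) : R[i]^o) : R^o).
  by apply/funext => w; rewrite mulrN raddfN /= ReiNIm opprK.
apply: (continuous_comp (f := fun w : R[i]^o => w * (- 'i%C) : R[i]^o)).
  exact: (@mulrr_continuous _ (- 'i%C) z).
exact: complex_Re_continuous.
Qed.

End ComplexNumbers.

Section ComplexForms.
Context {R : realType} {E : tvsType R}.

(** For a real linear form [l], this is its complex-linear extension. *)
Definition complex_form (l : E -> R^o) (w : complexification E) : R[i]^o :=
  (l w.1 +i* l w.2)%C.

Lemma complex_form_continuous (l : E -> R^o) :
  continuous l -> continuous (complex_form l).
Proof.
move=> lc w.
have -> : complex_form l =
    (fun w => (l w.1)%:C%C + 'i%C * (l w.2)%:C%C : R[i]^o).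
  by apply/funext => u; rewrite [LHS]complexE.
have c1 : {for w, continuous (fun u : complexification E => (l u.1)%:C%C : R[i]^o)}.
  apply: (continuous_comp (f := fun u : complexification E => l u.1 : R^o)).
    by apply: continuous_comp; [exact: (@cvg_fst E E)|exact: lc].
  exact: real_complex_continuous.
have c2 : {for w, continuous (fun u : complexification E => (l u.2)%:C%C : R[i]^o)}.
  apply: (continuous_comp (f := fun u : complexification E => l u.2 : R^o)).
    by apply: continuous_comp; [exact: (@cvg_snd E E)|exact: lc].
  exact: real_complex_continuous.
apply: cvgD; first exact: c1.
apply: (continuous_comp (g := fun z : R[i]^o => 'i%C * z : R[i]^o) c2).
exact: (@mulrl_continuous _ ('i%C : R[i])  _).
Qed.

Lemma complex_form_linear (l : E -> R^o) :
  (forall h x v, l (x + h *: v) = l x + h * l v) ->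
  forall (h : R[i]) x v,
    complex_form l (x + h *: v) = complex_form l x + h * complex_form l v.
Proof.
move=> ll.
have l0 : l 0 = 0.
  by have := ll (-1) 0 0; rewrite scaler0 addr0 mulN1r subrr.
have lZ h x : l (h *: x) = h * l x by rewrite -[h *: x]add0r ll l0 add0r.
have lD x y : l (x + y) = l x + l y by rewrite -[y]scale1r ll mul1r scale1r.
have lB x y : l (x - y) = l x - l y by rewrite -scaleN1r ll mulN1r.
move=> [a b] [x x'] [v v']; rewrite /complex_form.
rewrite [((x, x') + _).1]/(x + (a *: v - b *: v')).
rewrite [((x, x') + _).2]/(x' + (a *: v' + b *: v)).
by rewrite !(lB, lD, lZ) /=; simpc.
Qed.

End ComplexForms.

Section PointwiseCoordinates.
Context {R : realType} {X : Type}.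
Local Notation E := {ptws X -> R^o}.

Lemma ptws_proj_continuous (i : X) : continuous (fun f : E => f i : R^o).
Proof. exact: (@proj_continuous {classic X} (fun=> R^o) i). Qed.

Lemma ptws_cvg (S : Type) (G : set_system S) (g : S -> E) (f : E) :
  Filter G -> (forall i, (fun s => g s i : R^o) @ G --> (f i : R^o)) ->
  g @ G --> f.
Proof.
move=> FG H; apply/cvg_sup => i U [V [[W oW <-] Wf] WU].
apply: filterS WU _ => /=.
by apply: H; apply: open_nbhs_nbhs.
Qed.

Lemma ptws_coordinates :
  product_coordinates (fun (i : X) (f : E) => f i : R^o) (fun g => g : E).
Proof.
split => //.
- by move=> x y xy; apply/funext.
- exact: ptws_proj_continuous.
- by move=> S G g f FG; exact: ptws_cvg.
Qed.

(** The complexification of a real power is the complex power with the same index set. *)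
Lemma complex_ptws_coordinates :
  product_coordinates
    (fun (i : X) => complex_form (fun f : E => f i : R^o))
    (fun g => (fun i => complex.Re (g i), fun i => complex.Im (g i))
       : complexification E).
Proof.
split.
- by move=> i g; rewrite /complex_form /=; case: (g i).
- move=> [x x'] [y y'] xy; congr (_, _); apply/funext => i.
    by have [] := xy i.
  by have [] := xy i.
- by move=> i; exact: complex_form_linear.
- by move=> i; apply: complex_form_continuous; exact: ptws_proj_continuous.
- move=> S G g f FG H; rewrite [f]surjective_pairing.
  have -> : g = fun s => ((g s).1, (g s).2) :> complexification E.
    by apply/funext => s; rewrite -surjective_pairing.
  apply: (@cvg_pair _ _ _ _ (nbhs f.1) (nbhs f.2)) => /=.
    apply: ptws_cvg => i.
    exact: (@cvg_comp _ _ _ _ (@complex.Re R : R[i]^o -> R^o) _ _ _ (H i)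
      (@complex_Re_continuous R _)).
  apply: ptws_cvg => i.
  exact: (@cvg_comp _ _ _ _ (@complex.Im R : R[i]^o -> R^o) _ _ _ (H i)
    (@complex_Im_continuous R _)).
Qed.

End PointwiseCoordinates.

(** * The space of tree maps *)

Section StarTrees.

Definition star_adj (n : nat) : rel 'I_n.+1 := fun x y => (x == ord0) != (y == ord0).

(** Along a cycle the centre [ord0] occupies every other place, so a cycle with three or more
    vertices would repeat a vertex or contain a non-edge. *)
Lemma star_is_tree n : is_tree (@star_adj n).
Proof.
have c0 x : connect (@star_adj n) x ord0.
  have [->|x0] := eqVneq x ord0; first exact: connect0.
  by apply: connect1; rewrite /star_adj eqxx (negbTE x0).
have adjC : symmetric (@star_adj n) by move=> x y; rewrite /star_adj eq_sym.
split=> //.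
- by move=> x; rewrite /star_adj eqxx.
- by move=> x y; apply: connect_trans (c0 x) _; rewrite sym_connect_sym.
- case=> [|x [|y [|z c]]] //; rewrite /ucycle /= => /andP[].
  have [y0|y0] := eqVneq y ord0; last first.
    rewrite /star_adj (negbTE y0) => /and3P[].
    rewrite eqbF_neg negbK => /eqP -> ; rewrite eq_sym eqbF_neg negbK => /eqP -> _.
    by rewrite !inE eqxx orbT.
  rewrite /star_adj y0 eqxx; case: c => [|w c] /=.
    by case: (x == _); case: (z == _).
  case/and4P => _ z0 zw _; have w0 : w == ord0 by case: (w == _) zw z0; case: (z == _).
  by rewrite (eqP w0) !inE eqxx !orbT /= andbF.
Qed.

Definition star_tree (n : nat) : rooted_tree := RootedTree ord0 (@star_is_tree n).

Lemma star_tree_inj : injective (fun n => (\pi_tree (star_tree n))%qT).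
Proof.
by move=> m n /(congr1 (fun th => order (Some th))); rewrite !order_pi => -[].
Qed.

End StarTrees.

(** * Countability of the set of trees *)

Section Countability.

(** A tree is coded by its order, adjacency table and root; codes that are not trees are sent to the
    one-vertex tree. *)
Definition decode_tree
    (c : {n : nat & ({ffun 'I_n * 'I_n -> bool} * 'I_n)%type}) : rooted_tree :=
  match pselect (is_tree (fun x y => (tagged c).1 (x, y))) with
  | left h => RootedTree (tagged c).2 h
  | right _ => star_tree 0
  end.

Lemma tree_countable : exists en : nat -> tree, forall th, exists n, en n = th.
Proof.
pose C : countType := {n : nat & ({ffun 'I_n * 'I_n -> bool} * 'I_n)%type}.
pose en n := (\pi_tree (oapp decode_tree (star_tree 0) (unpickle n : option C)))%qT.
exists en => th; pose t := repr th.
pose adj := [ffun p : 'I_(tree_order t) * 'I_(tree_order t) => @tree_adj t p.1 p.2].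
have adjE : (fun x y => adj (x, y)) = @tree_adj t.
  by apply/funext => x; apply/funext => y; rewrite ffunE.
pose c : C := Tagged (fun n => ({ffun 'I_n * 'I_n -> bool} * 'I_n)%type) (adj, tree_root t).
exists (pickle c); rewrite /en pickleK /= -[RHS]reprK.
apply/eqmodP/asboolP; rewrite /decode_tree; case: pselect => [h|]; last first.
  by case; rewrite /= adjE; exact: tree_is_tree.
exists id; split=> //; first by exists id.
by move=> x y /=; rewrite ffunE.
Qed.

End Countability.

Section TreeMapSpace.
Context {R : realType}.
Local Notation E := {ptws tree -> R^o}.

Lemma ptws_hausdorff (X : Type) : hausdorff_space {ptws X -> R^o}.
Proof.
apply: (@hausdorff_product {classic X} (fun=> R^o)) => _; exact: norm_hausdorff.
Qed.

(** Expanding the indicators of [n.+1] distinct stars in [n] spanning vectors and evaluating at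
    these stars would factor the identity matrix of size [n.+1] through dimension [n]. *)
Lemma tree_maps_infinite_dimensional : infinite_dimensional E.
Proof.
move=> [n [b bE]].
pose th (k : 'I_n.+1) := (\pi_tree (star_tree k))%qT.
pose c (k : 'I_n.+1) := projT1 (cid (bE (fun x => (x == th k)%:R))).
have cE k x : \sum_(i < n) c k i * b i x = (x == th k)%:R.
  have := projT2 (cid (bE (fun x => (x == th k)%:R))) => /(congr1 (fun f : E => f x)) /= ->.
  rewrite (big_morph (fun f : E => f x) (id1 := 0) (op1 := +%R))//.
have : (\matrix_(k < n.+1, i < n) c k i) *m (\matrix_(i < n, k < n.+1) b i (th k)) = 1%:M.
  apply/matrixP => k l; rewrite !mxE; under eq_bigr do rewrite !mxE.
  rewrite cE; congr (_ %:R); rewrite eq_sym; congr nat_of_bool.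
  by apply/eqP/eqP => [/star_tree_inj/ord_inj|->].
by move=> /mulmx1_min; rewrite ltnn.
Qed.

Lemma tree_maps_frechet : frechet_space E.
Proof.
split; first exact: ptws_hausdorff.
have [en enP] := tree_countable.
(* The enumeration of trees turns the evaluations into a sequence of seminorms. *)
pose p n (f : E) : R := `|f (en n)|.
have pB n (f g : E) : p n (f - g) = `|f (en n) - g (en n)| by [].
have small (x : E) n (e : R) : 0 < e ->
    \forall y \near x, forall i, (i < n)%N -> p i (y - x) < e.
  move=> e0; elim: n => [|n IH].
    by apply: (@filterE _ (nbhs x) (nbhs_filter x)) => y i; rewrite ltn0.
  have H : \forall y \near x, p n (y - x) < e.
    have /cvgrPdist_lt/(_ e e0) := @ptws_proj_continuous R tree (en n) x.
    by apply: filterS => y; rewrite pB distrC.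
  apply: (@filterS2 _ (nbhs x) (nbhs_filter x) _ _ _ _ H IH) => y yn yi i.
  by rewrite ltnS leq_eqVlt => /predU1P[->//|]; exact: yi.
exists p; split.
- move=> n; split.
  + by move=> x; exact: normr_ge0.
  + by move=> x y; exact: ler_normD.
  + by move=> c x; rewrite /p -normrM.
- move=> x A; split; last first.
    move=> [n [e [e0 H]]]; have := small x n e e0; apply: filterS => y; exact: H.
  move=> xA; apply: contrapT => noA.
  (* Otherwise some sequence outside [A] converges to [x]. *)
  have H n : exists y : E, (forall i, (i < n)%N -> p i (y - x) < n.+1%:R^-1) /\ ~ A y.
    apply: contrapT => noy; apply: noA; exists n, n.+1%:R^-1; split => // y yn.
    by apply: contrapT => Ay; apply: noy; exists y.
  pose y n : E := projT1 (cid (H n)).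
  have yx : y @ \oo --> x.
    apply: ptws_cvg => th; have [i <-] := enP th.
    apply/cvgrPdist_lt => e e0.
    have [N _ HN] := near_infty_natSinv_lt (PosNum e0).
    near=> n; rewrite distrC.
    have [H1 _] := projT2 (cid (H n)).
    apply: (@lt_trans _ _ n.+1%:R^-1).
      by apply: H1; near: n; exact: nbhs_infty_gt.
    by apply: HN; near: n; exact: nbhs_infty_ge.
  have [N _ HN] := yx A xA.
  by have [_] := projT2 (cid (H N)); apply; apply: HN => /=.
- move=> u uC.
  (* The enumeration is onto, so the values at each single tree form a Cauchy sequence of reals;
     their limits give the limit tree map. *)
  have cu th : cvg ((fun n => u n th : R^o) @ \oo).
    apply/cauchy_cvgP/cauchy_exP => e e0; have [i <-] := enP th.
    have [N HN] := uC i e e0; exists (u N (en i)).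
    exists N => // n Nn /=.
    rewrite -ball_normE; exact: (HN N n (leqnn N) Nn).
  exists (fun th => lim ((fun n => u n th : R^o) @ \oo)).
  by apply: ptws_cvg => th; exact: cu.
Unshelve. all: by end_near. Qed.

End TreeMapSpace.

(** * The Lie group structure *)

Section TreeMapCoordinates.
Context {K : comPzRingType}.

(** The inverse chart on underlying functions: the value 1 at the empty tree accounts for the shift
    by the identity. *)
Definition extend (x : tree -> K) (tau : option tree) : K :=
  if tau is Some theta then x theta else 1.

End TreeMapCoordinates.

(** * Polynomiality of the product and the inverse *)

Section PolynomialButcher.
Context {K : numFieldType} {T : topologicalType} {E : tvsType K}.
Implicit Types (A B : option tree -> E -> K^o).

Lemma polyfam_opp (f : T -> E -> K^o) : polyfam f -> polyfam (fun t x => - f t x).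
Proof.
move=> pf; have -> : (fun t x => - f t x) = (fun t x => (-1 : K^o) * f t x).
  by apply/funext => t; apply/funext => x; rewrite mulN1r.
apply: polyfam_mul pf; apply: (@polyfam_cst _ _ _ (fun=> -1)); exact: cst_continuous.
Qed.

Lemma polyfam_butcher_prod A B :
  (forall tau, polyfam (fun (_ : T) x => A tau x)) ->
  (forall tau, polyfam (fun (_ : T) x => B tau x)) ->
  forall tau, polyfam (fun (_ : T) x => butcher_prod (A ^~ x) (B ^~ x) tau : K^o).
Proof.
move=> pA pB [theta|]; last exact: pB.
by apply: polyfam_sum => s; apply: polyfam_mul => //; apply: polyfam_prod.
Qed.

Lemma polyfam_butcher_inv A :
  (forall tau, polyfam (fun (_ : T) x => A tau x)) ->
  forall tau, polyfam (fun (_ : T) x => butcher_inv (A ^~ x) tau : K^o).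
Proof.
have pc (c : K^o) : polyfam (fun (_ : T) (_ : E) => c).
  by apply: (@polyfam_cst _ _ _ (fun=> c)); exact: cst_continuous.
move=> pA tau; rewrite /butcher_inv; move: (order tau) => n.
elim: n tau => [|n IH] [theta|]; try exact: pc.
apply: polyfam_opp; apply: polyfam_sum => s; apply: polyfam_mul => //.
by apply: polyfam_prod.
Qed.

Lemma polyfam_extend (x : tree -> E -> K^o) :
  (forall theta, polyfam (fun (_ : T) y => x theta y)) ->
  forall tau, polyfam (fun (_ : T) y => extend (x ^~ y) tau : K^o).
Proof.
move=> px [theta|]; first exact: px.
by apply: (@polyfam_cst _ _ _ (fun=> 1)); exact: cst_continuous.
Qed.

End PolynomialButcher.

Section RegularPolynomials.
Context {R : realType} {E : tvsType R} {X : Type}.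

(** [g] is the same family of polynomials in complexified coordinates; its real and imaginary parts
    form a holomorphic extension defined on the whole complexification. *)
Lemma regular_polynomial (f : E -> {ptws X -> R^o})
    (g : complexification E -> X -> R[i]) (r : regularity) :
  (forall (T : topologicalType) i, polyfam (fun (_ : T) x => f x i : R^o)) ->
  (forall (T : topologicalType) i, polyfam (fun (_ : T) w => g w i : R[i]^o)) ->
  (forall x i, g (x, 0) i = (f x i)%:C%C) ->
  regular r setT f.
Proof.
move=> pf pg gf; case: r => /=.
  by apply: (bastiani_smooth_polynomial (@ptws_coordinates R X)) => T i; exact: pf.
split; first exact: openT.
exists setT, (fun w => (fun i => complex.Re (g w i), fun i => complex.Im (g w i))).
split; last first.
  move=> x _; split => //.
  by congr (_, _); apply/funext => i; rewrite gf.
apply: (bastiani_smooth_polynomial (@complex_ptws_coordinates R X)) => T i.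
have -> : (fun (_ : T) w => complex_form (fun f : {ptws X -> R^o} => f i : R^o)
    (fun i => complex.Re (g w i), fun i => complex.Im (g w i))) =
  (fun (_ : T) w => g w i : R[i]^o).
  by apply/funext => t; apply/funext => w; rewrite /complex_form /=; case: (g w i).
exact: pg.
Qed.

Lemma polynomial_continuous (f : E -> {ptws X -> R^o}) :
  (forall (T : topologicalType) i, polyfam (fun (_ : T) x => f x i : R^o)) ->
  continuous f.
Proof.
move=> pf x; apply: ptws_cvg => i.
exact: (polyfam_continuousr (t := x) (pf E i)).
Qed.

End RegularPolynomials.

(** * The global chart *)

Section ButcherChart.
Context {R : realType}.
Local Notation E := {ptws tree -> R^o}.
Local Notation G := (butcher_group R).
Local Notation ch := (butcher_chart R).

Lemma butcher_group_eq (a b : G) : set_val a = set_val b -> a = b.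
Proof. exact: val_inj. Qed.

Lemma set_val_None (a : G) : set_val a None = 1.
Proof. exact: (set_valP a). Qed.

Lemma set_val_butcher_of (x : E) : set_val (butcher_of x) = extend (x : tree -> R).
Proof.
apply/funext => -[theta|]; [exact: add0r|exact: addr0].
Qed.

Lemma chart_funE (a : G) theta : chart_fun ch a theta = set_val a (Some theta).
Proof. by rewrite /= subr0. Qed.

Lemma chart_funK : cancel (chart_fun ch) (chart_inv ch).
Proof.
move=> a; apply: butcher_group_eq; rewrite [LHS]set_val_butcher_of.
by apply/funext => -[theta|]; rewrite ?set_val_None //= subr0.
Qed.

Lemma chart_invK : cancel (chart_inv ch) (chart_fun ch).
Proof.
by move=> x; apply/funext => theta; rewrite chart_funE [chart_inv _ _]/= set_val_butcher_of.
Qed.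

Lemma set_val_continuous : continuous (set_val : G -> {ptws option tree -> R^o}).
Proof. exact: initial_continuous. Qed.

Lemma chart_fun_continuous : continuous (chart_fun ch).
Proof.
move=> a; apply: (@ptws_cvg R tree _ _ _ _ (nbhs_filter a)) => theta.
under eq_fun do rewrite chart_funE.
rewrite chart_funE.
exact: (continuous_comp (@set_val_continuous a) (@ptws_proj_continuous R _ (Some theta) _)).
Qed.

Lemma chart_inv_continuous : continuous (chart_inv ch).
Proof.
(* The group carries the initial topology for [set_val], so continuity is tested on the value at
   each tree. *)
apply: (@continuous_comp_initial _ E {ptws option tree -> R^o}
  (set_val : set_type (@butcher_set R) -> _) (@butcher_of R)) => x.
apply: (@ptws_cvg R _ _ _ _ _ (nbhs_filter x)) => tau.
have -> : (fun y : E => (set_val \o @butcher_of R) y tau : R^o) =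
    (fun y : E => extend (y : tree -> R) tau).
  by apply/funext => y; rewrite /= -set_val_butcher_of.
rewrite [X in _ --> X](_ : _ = extend (x : tree -> R) tau); last first.
  by rewrite /= -set_val_butcher_of.
case: tau => [theta|]; last exact: cvg_cst.
move=> A; exact: (@ptws_proj_continuous R tree theta x A).
Qed.

(** The chart is continuous and injective into a Hausdorff space. *)
Lemma butcher_group_hausdorff : hausdorff_space G.
Proof.
move=> a b ab; rewrite -(chart_funK a) -(chart_funK b); congr chart_inv.
apply: (@ptws_hausdorff R tree) => U V Ua Vb.
have [c [Uc Vc]] := ab _ _ (@chart_fun_continuous a _ Ua) (@chart_fun_continuous b _ Vb).
by exists (chart_fun ch c).
Qed.

End ButcherChart.

(** * Group laws and regularity of the operations *)

Section ButcherLieGroup.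
Context {R : realType}.
Local Notation E := {ptws tree -> R^o}.
Local Notation G := (butcher_group R).
Local Notation ch := (butcher_chart R).

Lemma set_val_butcher_mul (a b : G) :
  set_val (butcher_mul a b) = butcher_prod (set_val a) (set_val b).
Proof. by apply/funext => -[]. Qed.

Lemma butcher_group_inv_subproof (a : G) :
  butcher_inv (set_val a) \in @butcher_set R.
Proof. exact: mem_set. Qed.

Definition butcher_group_inv (a : G) : G :=
  exist _ (butcher_inv (set_val a)) (butcher_group_inv_subproof a).

Lemma butcher_is_group :
  is_group (@butcher_mul R) butcher_group_inv (butcher_one R).
Proof.
have oneE : set_val (butcher_one R) = butcher_unit by apply/funext => -[].
have mulA : associative (@butcher_mul R).
  move=> a b c; apply: butcher_group_eq; rewrite !set_val_butcher_mul.
  by apply/funext => tau; rewrite -butcher_prodA// set_val_None.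
have mul1 : left_id (butcher_one R) (@butcher_mul R).
  move=> a; apply: butcher_group_eq; rewrite set_val_butcher_mul oneE.
  by apply/funext => tau; rewrite butcher_unit_prod// set_val_None.
have mulr1 : right_id (butcher_one R) (@butcher_mul R).
  move=> a; apply: butcher_group_eq; rewrite set_val_butcher_mul oneE.
  by apply/funext => tau; rewrite butcher_prod_unit// set_val_None.
have mulV : left_inverse (butcher_one R) butcher_group_inv (@butcher_mul R).
  move=> a; apply: butcher_group_eq; rewrite set_val_butcher_mul oneE.
  by apply/funext => tau; rewrite butcher_inv_prod// set_val_None.
(* The left inverse is also a right inverse: the left law for the inverse of [a] is multiplied on
   the right by the product of [a] and its inverse. *)
split => // a; have := mulV (butcher_group_inv a).
move=> /(congr1 (fun x => butcher_mul x (butcher_mul a (butcher_group_inv a)))).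
by rewrite mul1 -mulA [X in butcher_mul _ X]mulA mulV mul1 mulV.
Qed.

Lemma butcher_is_chart : is_chart ch.
Proof.
have cod : chart_cod ch = setT.
  apply/seteqP; split => // x _; exists (chart_inv ch x) => //; exact: chart_invK.
split.
- exact: openT.
- by rewrite cod; exact: openT.
- by move=> a _; exact: chart_funK.
- by apply: continuous_subspaceT; exact: chart_fun_continuous.
- by rewrite cod; apply: continuous_subspaceT; exact: chart_inv_continuous.
Qed.

Let polyfam_proj (T : topologicalType) (theta : tree) :
  polyfam (fun (_ : T) (x : E) => x theta : R^o).
Proof. by apply: polyfam_lin => //; exact: ptws_proj_continuous. Qed.

Let complex_proj (theta : tree) : complexification E -> R[i]^o :=
  complex_form (fun x : E => x theta : R^o).

Let polyfam_complex_proj (T : topologicalType) (theta : tree) :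
  polyfam (fun (_ : T) w => complex_proj theta w).
Proof.
apply: polyfam_lin.
  by apply: complex_form_continuous; exact: ptws_proj_continuous.
exact: complex_form_linear.
Qed.

Lemma butcher_transition_regular r : regular r setT (id : E -> E).
Proof.
by apply: (regular_polynomial (g := fun w theta => complex_proj theta w)).
Qed.

Lemma butcher_is_manifold r : is_manifold r [set ch].
Proof.
split; [exact: ptws_hausdorff|exact: butcher_group_hausdorff|split].
- by move=> _ ->; exact: butcher_is_chart.
- by move=> a; exists ch.
- move=> _ _ -> ->.
  have -> : chart_fun ch \o chart_inv ch = id by apply/funext => x; exact: chart_invK.
  rewrite (_ : _ @` _ = setT); first exact: butcher_transition_regular.
  apply/seteqP; split => // x _; exists (chart_inv ch x) => //; exact: chart_invK.
Qed.

Let fst_coord_continuous (theta : tree) :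
  continuous (fun p : E * E => p.1 theta : R^o).
Proof.
move=> p.
exact: (continuous_comp (@cvg_fst E E _ _ _) (@ptws_proj_continuous R _ theta p.1)).
Qed.

Let snd_coord_continuous (theta : tree) :
  continuous (fun p : E * E => p.2 theta : R^o).
Proof.
move=> p.
exact: (continuous_comp (@cvg_snd E E _ _ _) (@ptws_proj_continuous R _ theta p.2)).
Qed.

Let mul_coord (p : E * E) : E := fun theta =>
  butcher_prod (extend (p.1 : tree -> R)) (extend (p.2 : tree -> R)) (Some theta).

Let polyfam_mul_coord (T : topologicalType) theta :
  polyfam (fun (_ : T) p => mul_coord p theta : R^o).
Proof.
apply: (polyfam_butcher_prod (A := fun tau (p : E * E) => extend (p.1 : tree -> R) tau)
  (B := fun tau (p : E * E) => extend (p.2 : tree -> R) tau)) => tau.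
- apply: (polyfam_extend (x := fun th (p : E * E) => p.1 th)) => th.
  by apply: polyfam_lin => //; exact: fst_coord_continuous.
- apply: (polyfam_extend (x := fun th (p : E * E) => p.2 th)) => th.
  by apply: polyfam_lin => //; exact: snd_coord_continuous.
Qed.

Lemma butcher_mul_coord_regular r : regular r setT mul_coord.
Proof.
pose pr1 th : complexification (E * E)%type -> R[i]^o :=
  complex_form (fun p : E * E => p.1 th : R^o).
pose pr2 th : complexification (E * E)%type -> R[i]^o :=
  complex_form (fun p : E * E => p.2 th : R^o).
apply: (regular_polynomial (g := fun w theta =>
   butcher_prod (extend (pr1 ^~ w)) (extend (pr2 ^~ w)) (Some theta))).
- by move=> T theta; exact: polyfam_mul_coord.
- move=> T theta.
  apply: (polyfam_butcher_prod (A := fun tau w => extend (pr1 ^~ w) tau)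
    (B := fun tau w => extend (pr2 ^~ w) tau)) => tau.
  + apply: polyfam_extend => th; apply: polyfam_lin; last exact: complex_form_linear.
    by apply: complex_form_continuous; exact: fst_coord_continuous.
  + apply: polyfam_extend => th; apply: polyfam_lin; last exact: complex_form_linear.
    by apply: complex_form_continuous; exact: snd_coord_continuous.
(* At real points the complex product is the image of the real one under the ring embedding. *)
- move=> [x y] theta; rewrite [RHS](rmorph_butcher_prod (real_complex R)).
  by congr butcher_prod; apply/funext => -[].
Qed.

Let inv_coord (x : E) : E := fun theta =>
  butcher_inv (extend (x : tree -> R)) (Some theta).

Let polyfam_inv_coord (T : topologicalType) theta :
  polyfam (fun (_ : T) p => inv_coord p theta : R^o).
Proof.
apply: (polyfam_butcher_inv (A := fun tau (x : E) => extend (x : tree -> R) tau)) => tau.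
by apply: (polyfam_extend (x := fun th (p : E) => p th)).
Qed.

Lemma butcher_inv_coord_regular r : regular r setT inv_coord.
Proof.
apply: (regular_polynomial (g := fun w theta =>
   butcher_inv (extend (complex_proj ^~ w)) (Some theta))).
- by move=> T theta; exact: polyfam_inv_coord.
- move=> T theta.
  apply: (polyfam_butcher_inv (A := fun tau w => extend (complex_proj ^~ w) tau)) => tau.
  exact: polyfam_extend.
- move=> x theta; rewrite [RHS](rmorph_butcher_inv (real_complex R)).
  by congr butcher_inv; apply/funext => -[].
Qed.

(** Factoring through the chart yields both the continuity of multiplication on the group and its
    polynomial expression in coordinates. *)
Let mulE (p : G * G) :
  butcher_mul p.1 p.2 =
  chart_inv ch (mul_coord (chart_fun ch p.1, chart_fun ch p.2)).
Proof.
rewrite -[LHS]chart_funK; congr chart_inv; apply/funext => theta.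
rewrite chart_funE set_val_butcher_mul /mul_coord.
by congr butcher_prod; rewrite -set_val_butcher_of [butcher_of _]chart_funK.
Qed.

Let invE (a : G) :
  butcher_group_inv a = chart_inv ch (inv_coord (chart_fun ch a)).
Proof.
rewrite -[LHS]chart_funK; congr chart_inv; apply/funext => theta.
rewrite chart_funE /inv_coord.
by congr butcher_inv; rewrite -set_val_butcher_of [butcher_of _]chart_funK.
Qed.

Lemma butcher_mul_regular r :
  regular_map r (prod_atlas [set ch] [set ch]) [set ch]
    (fun x : G * G => butcher_mul x.1 x.2).
Proof.
split.
  have -> : (fun x : G * G => butcher_mul x.1 x.2) = chart_inv ch \o (mul_coord \o
      (fun x => (chart_fun ch x.1, chart_fun ch x.2))).
    by apply/funext => p; exact: mulE.
  move=> p; apply: continuous_comp; last exact: chart_inv_continuous.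
  apply: continuous_comp; last first.
    by apply: polynomial_continuous => T i; exact: polyfam_mul_coord.
  apply: (@cvg_pair _ _ _ _ (nbhs (chart_fun ch p.1)) (nbhs (chart_fun ch p.2))) => /=.
    exact: (continuous_comp (@cvg_fst G G _ _ _) (@chart_fun_continuous R p.1)).
  exact: (continuous_comp (@cvg_snd G G _ _ _) (@chart_fun_continuous R p.2)).
move=> _ _ [_ -> [_ -> <-]] ->.
have -> : chart_fun ch \o (fun x : G * G => butcher_mul x.1 x.2) \o
    chart_inv (prod_chart ch ch) = mul_coord.
  apply/funext => -[x y].
  apply: etrans (congr1 (chart_fun ch) (mulE (chart_inv ch x, chart_inv ch y))) _.
  rewrite chart_invK.
  by congr mul_coord; congr pair; exact: chart_invK.
rewrite (_ : _ @` _ = setT); first exact: butcher_mul_coord_regular.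
apply/seteqP; split => // -[x y] _; exists (chart_inv ch x, chart_inv ch y) => //.
by congr (_, _); exact: chart_invK.
Qed.

Lemma butcher_inv_regular r :
  regular_map r [set ch] [set ch] butcher_group_inv.
Proof.
split.
  have -> : butcher_group_inv = chart_inv ch \o (inv_coord \o chart_fun ch).
    by apply/funext => p; exact: invE.
  move=> p; apply: continuous_comp; last exact: chart_inv_continuous.
  apply: continuous_comp; first exact: chart_fun_continuous.
  by apply: polynomial_continuous => T i; exact: polyfam_inv_coord.
move=> _ _ -> ->.
have -> : chart_fun ch \o butcher_group_inv \o chart_inv ch = inv_coord.
  apply/funext => x; apply: etrans (congr1 (chart_fun ch) (invE (chart_inv ch x))) _.
  by rewrite !chart_invK.
rewrite (_ : _ @` _ = setT); first exact: butcher_inv_coord_regular.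
by apply/seteqP; split => // x _; exists (chart_inv ch x) => //; exact: chart_invK.
Qed.

Lemma butcher_is_lie_group r :
  is_lie_group r [set ch] (@butcher_mul R) butcher_group_inv (butcher_one R).
Proof.
split; [exact: butcher_is_group|exact: butcher_is_manifold|
  exact: butcher_mul_regular|exact: butcher_inv_regular].
Qed.

End ButcherLieGroup.

Theorem theoremA (R : realType) :
  frechet_space {ptws tree -> R^o} /\
  infinite_dimensional {ptws tree -> R^o} /\
  exists inv : butcher_group R -> butcher_group R,
    is_real_analytic_lie_group [set butcher_chart R]
      (@butcher_mul R) inv (butcher_one R).
Proof.
split; first exact: tree_maps_frechet.
split; first exact: tree_maps_infinite_dimensional.
by exists butcher_group_inv; split; exact: butcher_is_lie_group.
Qed.
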